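(* The contravariant hom-functor $C\colon \mathsf{PosComp}^{\mathrm{op}}\to\overline{\mathsf{A}}$ corestricts to an equivalence of categories $C\colon \mathsf{PosComp}^{\mathrm{op}}\to\overline{\mathsf{A}}_0$. Hence, $\overline{\mathsf{A}}_0$ is closed in $\overline{\mathsf{A}}$ under $\aleph_1$-directed colimits, and therefore $\overline{\mathsf{A}}_0$ is also an $\aleph_1$-ary quasivariety.
   Context: A partially ordered compact space is a triple $(X,\leq,\tau)$ where $\leq$ is a partial order on the set $X$ and $\tau$ is a compact topology on $X$ such that $\{(x,y)\mid x\leq y\}$ is closed in $X\times X$ (hence $\tau$ is Hausdorff). $\mathsf{PosComp}$ is the category of these spaces and monotone continuous maps. The unit interval $[0,1]$ with the Euclidean topology and the order ''greater or equal'' $\geqslant$ is such a space (via $u\mapsto 1-u$ it is isomorphic to the same space with order $\leqslant$). An $\aleph_1$-ary quasivariety is a category consisting of all algebras and homomorphisms for a (one-sorted) signature given by a set of operation symbols of arity less than $\aleph_1$ (i.e. countable), subject to a set of implications of the form $\bigwedge_{i\in I}(s_i=t_i)\Rightarrow (s=t)$ with $I$ countable (equations being the case $I=\varnothing$). For $u,v\in[0,1]$ let $u\odot v=\max(0,u+v-1)$. The $\aleph_1$-ary quasivariety $\mathsf{A}$ has as operations: constants $\bot,\top$; unary operations $-\odot u$ and $-\pitchfork u$ for each $u\in[0,1]$; binary operations $\vee$ and $\circledcirc$. Writing $x\leq y$ for $y=x\vee y$, the axioms are (for all elements $x,y,z$ and all $u,v\in[0,1]$): (1) $x\vee x=x$,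 $x\vee(y\vee z)=(x\vee y)\vee z$, $x\vee\bot=x$, $x\vee y=y\vee x$; (2) $x\odot 1=x$, $(x\odot u)\odot v=x\odot(u\odot v)$, $\bot\odot u=\bot$, $(x\vee y)\odot u=(x\odot u)\vee(y\odot u)$; (3) $x\odot u\leq x\odot v$ whenever $u\leqslant v$; and for every countable $S\subseteq[0,1]$ with $v=\sup S$: $\bigwedge_{u\in S}(x\odot u\leq y)\Rightarrow x\odot v\leq y$; (4) $x\odot u\leq y\iff x\leq y\pitchfork u$; (5) $x\circledcirc y=y\circledcirc x$, $x\circledcirc(y\circledcirc z)=(x\circledcirc y)\circledcirc z$, $x\circledcirc\top=x$, $x\leq\top$; (6) $x\circledcirc(y\vee z)=(x\circledcirc y)\vee(x\circledcirc z)$, $x\circledcirc\bot=\bot$, $x\circledcirc(y\odot u)=(x\circledcirc y)\odot u$. The set $[0,1]$ is an algebra of $\mathsf{A}$ with $\bot=0$, $\top=1$, $\vee=\max$, $\circledcirc=\odot$ and $v\pitchfork u=\min(1,1-u+v)$. Let $\mathcal{C}\subseteq[0,1]^{\mathbb{N}}$ be the set of increasing sequences $(u_n)$ with $u_{n+1}-u_n\leqslant\frac{1}{2^n}$ for all $n$; every such sequence converges, and $\lim\colon\mathcal{C}\to[0,1]$ takes the limit. Let $\mu\colon[0,1]^{\mathbb{N}}\to[0,1]^{\mathbb{N}}$, $\mu((u_n)_n)=(\max(u_0,\dots,u_n))_n$, and $\gamma\colon[0,1]^{\mathbb{N}}\to[0,1]^{\mathbb{N}}$, $\gamma((u_n)_n)=(v_n)_n$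 with $v_0=u_0$, $v_{n+1}=\min(u_{n+1},v_n+\frac{1}{2^n})$. Then $\gamma\cdot\mu$ takes values in $\mathcal{C}$; put $\delta=\lim\cdot\gamma\cdot\mu\colon[0,1]^{\mathbb{N}}\to[0,1]$, which is monotone and continuous. $\overline{\mathsf{A}}$ is the $\aleph_1$-ary quasivariety obtained from $\mathsf{A}$ by adding one operation symbol of arity $\mathbb{N}$ (with no further axioms); its morphisms are the homomorphisms for all operations. $[0,1]$ is an object of $\overline{\mathsf{A}}$ by interpreting the new symbol as $\delta$. $\overline{\mathsf{A}}_0$ is the full subcategory of $\overline{\mathsf{A}}$ on those objects $A$ for which the cone of all $\overline{\mathsf{A}}$-morphisms $A\to[0,1]$ is point-separating (i.e. for $a\neq b$ in $A$ there is a morphism $\varphi\colon A\to[0,1]$ with $\varphi(a)\neq\varphi(b)$). The functor $C\colon\mathsf{PosComp}^{\mathrm{op}}\to\overline{\mathsf{A}}$ sends $X$ to $CX=\{f\colon X\to[0,1]\mid f\text{ monotone and continuous}\}$ with all operations defined pointwise, and $f\colon X\to Y$ to $Cf\colon CY\to CX$, $\psi\mapsto\psi\cdot f$. *)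

(* Defs.v *)
From HB Require Import structures.
From mathcomp Require Import all_boot all_order all_algebra.
From mathcomp Require Import all_classical all_reals all_analysis.
From mathcomp Require Import lra.

Set Implicit Arguments.
Unset Strict Implicit.
Unset Printing Implicit Defensive.

Import Order.TTheory GRing.Theory Num.Theory.
Import numFieldNormedType.Exports.

Local Open Scope classical_set_scope.
Local Open Scope ring_scope.

Record category := Category {
  obj :> Type;
  hom : obj -> obj -> Type;
  idc : forall a, hom a a;
  comp : forall a b c, hom b c -> hom a b -> hom a c;
  comp1f : forall a b (f : hom a b), comp (idc b) f = f;
  compf1 : forall a b (f : hom a b), comp f (idc a) = f;
  compA : forall a b c d (h : hom c d) (g : hom b c) (f : hom a b),
    comp h (comp g f) = comp (comp h g) f }.

Arguments idc {_} a.

Definition op (K : category) : category :=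
  @Category K (fun a b => hom b a) (fun a => idc a)
    (fun a b c g f => comp f g)
    (fun a b f => compf1 f) (fun a b f => comp1f f)
    (fun a b c d h g f => esym (compA f g h)).

Definition full_sub (K : category) (P : K -> Prop) : category :=
  @Category {a : K | P a} (fun a b => hom (sval a) (sval b))
    (fun a => idc (sval a)) (fun a b c g f => comp g f)
    (fun a b f => comp1f f) (fun a b f => compf1 f)
    (fun a b c d h g f => compA h g f).

Record functor (K L : category) := Functor {
  fobj :> K -> L;
  fmap : forall a b, hom a b -> hom (fobj a) (fobj b);
  fmap1 : forall a, fmap (idc a) = idc (fobj a);
  fmapM : forall a b c (g : hom b c) (f : hom a b),
    fmap (comp g f) = comp (fmap g) (fmap f) }.

Arguments fmap {K L} _ {a b} _.

Definition id_functor (K : category) : functor K K :=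
  @Functor K K id (fun a b f => f) (fun a => erefl) (fun a b c g f => erefl).

Lemma comp_functor1 (K L M : category) (G : functor L M) (F : functor K L) a :
  fmap G (fmap F (idc a)) = idc (G (F a)).
Proof. by rewrite !fmap1. Qed.

Lemma comp_functorM (K L M : category) (G : functor L M) (F : functor K L)
    a b c (g : hom b c) (f : hom a b) :
  fmap G (fmap F (comp g f)) = comp (fmap G (fmap F g)) (fmap G (fmap F f)).
Proof. by rewrite !fmapM. Qed.

Definition comp_functor (K L M : category) (G : functor L M) (F : functor K L) :
    functor K M :=
  @Functor K M (fun a => G (F a)) (fun a b f => fmap G (fmap F f))
    (comp_functor1 G F) (comp_functorM G F).

Definition corestrict (K L : category) (P : L -> Prop) (F : functor K L)
    (PF : forall a, P (F a)) : functor K (full_sub P) :=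
  @Functor K (full_sub P) (fun a => exist P (F a) (PF a))
    (fun a b f => fmap F f) (fun a => fmap1 F a) (fun a b c g f => fmapM F g f).

Definition is_iso (K : category) (a b : K) (f : hom a b) : Prop :=
  exists g : hom b a, comp g f = idc a /\ comp f g = idc b.

Definition nat_isomorphic (K L : category) (F G : functor K L) : Prop :=
  exists eta : forall a, hom (F a) (G a),
    (forall a b (f : hom a b), comp (eta b) (fmap F f) = comp (fmap G f) (eta a))
    /\ (forall a, is_iso (eta a)).

Definition is_equivalence (K L : category) (F : functor K L) : Prop :=
  exists G : functor L K,
    nat_isomorphic (comp_functor G F) (id_functor K) /\
    nat_isomorphic (comp_functor F G) (id_functor L).

Definition poset_cat d (I : porderType d) : category :=
  @Category I (fun i j => (i <= j)%O) (fun i => lexx i)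
    (fun i j k hjk hij => le_trans hij hjk)
    (fun _ _ _ => bool_irrelevance _ _) (fun _ _ _ => bool_irrelevance _ _)
    (fun _ _ _ _ _ _ _ => bool_irrelevance _ _).

(* The case S = set0 makes I nonempty. *)
Definition aleph1_directed d (I : porderType d) : Prop :=
  forall S : set I, countable S -> exists i, ubound S i.

Definition is_cocone (J K : category) (D : functor J K) (c : K)
    (iota : forall j, hom (D j) c) : Prop :=
  forall i j (f : hom i j), comp (iota j) (fmap D f) = iota i.

Definition is_colimit (J K : category) (D : functor J K) (c : K)
    (iota : forall j, hom (D j) c) : Prop :=
  is_cocone iota /\
  forall (c' : K) (iota' : forall j, hom (D j) c'), is_cocone iota' ->
    exists! h : hom c c', forall j, comp h (iota j) = iota' j.

Definition closed_aleph1_directed_colimits (K : category) (P : K -> Prop) :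
    Prop :=
  forall d (I : porderType d), aleph1_directed I ->
  forall (D : functor (poset_cat I) K) (c : K) (iota : forall i, hom (D i) c),
    is_colimit iota -> (forall i, P (D i)) -> P c.

Record signature := Signature { osym : Type; arity : osym -> countType }.

Record algebra (Sg : signature) := Algebra {
  carrier :> Type;
  interp : forall o : osym Sg, (arity o -> carrier) -> carrier }.

Arguments interp {Sg} _ o _.

Record alg_hom (Sg : signature) (A B : algebra Sg) := AlgHom {
  alg_fun :> A -> B;
  alg_funE : forall (o : osym Sg) (a : arity o -> A),
    alg_fun (interp A o a) = interp B o (alg_fun \o a) }.

Lemma alg_hom_ext (Sg : signature) (A B : algebra Sg) (f g : alg_hom A B) :
  f =1 g -> f = g.
Proof.
case: f g => [f hf] [g hg] /= /funext fg; subst g.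
by rewrite (Prop_irrelevance hf hg).
Qed.

Definition alg_id (Sg : signature) (A : algebra Sg) : alg_hom A A :=
  @AlgHom Sg A A id (fun o a => erefl).

Lemma alg_comp_subproof (Sg : signature) (A B C : algebra Sg)
    (g : alg_hom B C) (f : alg_hom A B) (o : osym Sg) (a : arity o -> A) :
  (g \o f) (interp A o a) = interp C o ((g \o f) \o a).
Proof. by rewrite /= !alg_funE. Qed.

Definition alg_comp (Sg : signature) (A B C : algebra Sg)
    (g : alg_hom B C) (f : alg_hom A B) : alg_hom A C :=
  AlgHom (alg_comp_subproof g f).

Definition alg_cat (Sg : signature) : category.
Proof.
by refine (@Category (algebra Sg) (@alg_hom Sg) (@alg_id Sg) (@alg_comp Sg)
  _ _ _) => *; exact: alg_hom_ext.
Defined.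

(* Arities are countable and an implication has countably many premises, so
   countably many variables suffice. *)
Inductive term (Sg : signature) :=
| Var of nat
| App (o : osym Sg) of (arity o -> term Sg).

Arguments Var {Sg} _.
Arguments App {Sg} o _.

Fixpoint eval (Sg : signature) (A : algebra Sg) (e : nat -> A) (t : term Sg) :
    A :=
  match t with
  | Var n => e n
  | App o a => interp A o (fun i => eval e (a i))
  end.

Definition equation (Sg : signature) := (term Sg * term Sg)%type.

Record implication (Sg : signature) := Implication {
  premises : set (equation Sg);
  conclusion : equation Sg;
  premises_countable : countable premises }.

Definition holds (Sg : signature) (A : algebra Sg) (e : nat -> A)
    (q : equation Sg) : Prop := eval e q.1 = eval e q.2.

Definition models (Sg : signature) (Q : set (implication Sg)) (A : algebra Sg) :
    Prop :=
  forall i, Q i -> forall e : nat -> A,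
    (forall q, premises i q -> holds e q) -> holds e (conclusion i).

Definition quasivariety (Sg : signature) (Q : set (implication Sg)) : category :=
  @full_sub (alg_cat Sg) (models Q).

(* K is read as the full subcategory of alg_cat Sg on the algebras satisfying K:
   its objects must be exactly the models of a set of implications. *)
Definition is_aleph1_quasivariety (Sg : signature) (K : algebra Sg -> Prop) :
    Prop :=
  exists Q : set (implication Sg), forall A, K A <-> models Q A.

Definition unconditional (Sg : signature) (q : equation Sg) : implication Sg :=
  @Implication Sg set0 q (countable0 _).

Definition implies1 (Sg : signature) (p q : equation Sg) : implication Sg :=
  @Implication Sg [set p] q (countable1 p).

Lemma eval_hom (Sg : signature) (A B : algebra Sg) (f : alg_hom A B)
    (e : nat -> A) (t : term Sg) : f (eval e t) = eval (f \o e) t.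
Proof.
elim: t => //= o a IH; rewrite alg_funE; congr interp.
by apply/funext => i /=.
Qed.

Lemma models_separated (Sg : signature) (Q : set (implication Sg))
    (A B : algebra Sg) (J : Type) (f : J -> alg_hom A B) :
  (forall x y, (forall j, f j x = f j y) -> x = y) ->
  models Q B -> models Q A.
Proof.
move=> finj QB i Qi e he; apply: finj => j; rewrite !eval_hom.
by apply: QB => // q /he; rewrite /holds -!eval_hom => ->.
Qed.

Record posComp := PosCompSpace {
  pc_sort :> POrderedTopological.type Order.default_display;
  pc_compact : compact [set: pc_sort];
  pc_closed : closed [set xy : pc_sort * pc_sort | (xy.1 <= xy.2)%O] }.

Record pc_hom (X Y : posComp) := PCHom {
  pc_fun :> X -> Y;
  pc_continuous : continuous pc_fun;
  pc_monotone : {homo pc_fun : x y / (x <= y)%O} }.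

Lemma pc_hom_ext (X Y : posComp) (f g : pc_hom X Y) : f =1 g -> f = g.
Proof.
case: f g => [f cf mf] [g cg mg] /= /funext fg; subst g.
by rewrite (Prop_irrelevance cf cg) (Prop_irrelevance mf mg).
Qed.

Lemma pc_id_continuous (X : posComp) : continuous (id : X -> X).
Proof. by move=> x. Qed.

Definition pc_id (X : posComp) : pc_hom X X :=
  @PCHom X X id (@pc_id_continuous X) (fun x y h => h).

Lemma pc_comp_continuous (X Y Z : posComp) (g : pc_hom Y Z) (f : pc_hom X Y) :
  continuous (g \o f).
Proof. by move=> x; apply: continuous_comp; exact: pc_continuous. Qed.

Definition pc_comp (X Y Z : posComp) (g : pc_hom Y Z) (f : pc_hom X Y) :
    pc_hom X Z :=
  @PCHom X Z (g \o f) (@pc_comp_continuous X Y Z g f)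
    (fun x y h => pc_monotone g (pc_monotone f h)).

Definition PosComp : category.
Proof.
by refine (@Category posComp pc_hom pc_id pc_comp _ _ _) => *;
  exact: pc_hom_ext.
Defined.

Definition unit_itv (R : realType) : Type := set_type `[0 : R, 1].

HB.instance Definition _ (R : realType) :=
  Topological.copy (unit_itv R) (set_type `[0 : R, 1]).

Section UnitInterval.
Context {R : realType}.
Notation I01 := (unit_itv R).
Implicit Types u v w : I01.

Definition uval u : R := set_val u.

Lemma uval_inj : injective uval.
Proof. by move=> u v uv; apply: eq_sig_hprop => // x; exact: bool_irrelevance. Qed.

Lemma uval_itv u : 0 <= uval u <= 1.
Proof. by have := set_valP u; rewrite /= in_itv. Qed.

Lemma mk_unit_subproof (x : R) : 0 <= x <= 1 -> x \in [set` `[0 : R, 1]].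
Proof. by move=> h; rewrite inE /= in_itv. Qed.

Definition mk_unit (x : R) (h : 0 <= x <= 1) : I01 :=
  exist _ x (mk_unit_subproof h).

Lemma mk_unitK (x : R) (h : 0 <= x <= 1) : uval (mk_unit h) = x.
Proof. by []. Qed.

Definition uge u v : bool := uval v <= uval u.

Lemma uge_refl : reflexive uge.
Proof. by move=> u; rewrite /uge. Qed.

Lemma uge_anti : antisymmetric uge.
Proof. by move=> u v h; apply: uval_inj; apply/esym/le_anti. Qed.

Lemma uge_trans : transitive uge.
Proof. by move=> v u w uv vw; exact: le_trans vw uv. Qed.

(* This makes (u <= v)%O mean uval v <= uval u: as a partially ordered compact
   space, [0, 1] carries the order "greater or equal". *)
HB.instance Definition _ :=
  Order.Le_isPOrder.Build Order.default_display I01 uge_refl uge_anti uge_trans.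

Lemma u0_subproof : 0 <= (0 : R) <= 1. Proof. lra. Qed.
Lemma u1_subproof : 0 <= (1 : R) <= 1. Proof. lra. Qed.
Lemma umax_subproof u v : 0 <= Num.max (uval u) (uval v) <= 1.
Proof. by have := uval_itv u; have := uval_itv v; case: (lerP (uval u) (uval v)); lra. Qed.
Lemma utens_subproof u v : 0 <= Num.max 0 (uval u + uval v - 1) <= 1.
Proof. by have := uval_itv u; have := uval_itv v; case: (lerP 0 (uval u + uval v - 1)); lra. Qed.
Lemma upitch_subproof v u : 0 <= Num.min 1 (1 - uval u + uval v) <= 1.
Proof. by have := uval_itv u; have := uval_itv v; case: (lerP 1 (1 - uval u + uval v)); lra. Qed.

Definition u0 : I01 := mk_unit u0_subproof.
Definition u1 : I01 := mk_unit u1_subproof.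
Definition umax u v : I01 := mk_unit (umax_subproof u v).
Definition utens u v : I01 := mk_unit (utens_subproof u v).
Definition upitch v u : I01 := mk_unit (upitch_subproof v u).

(* The supremum is taken in [0, 1]: the supremum of set0 is 0. *)
Definition is_usup (S : set I01) v : Prop :=
  (forall u, S u -> uval u <= uval v) /\
  forall w, (forall u, S u -> uval u <= uval w) -> uval v <= uval w.

Fixpoint mu (u : nat -> R) (n : nat) : R :=
  if n is m.+1 then Num.max (mu u m) (u m.+1) else u 0%N.

Fixpoint gamma (u : nat -> R) (n : nat) : R :=
  if n is m.+1 then Num.min (u m.+1) (gamma u m + 1 / 2 ^+ m) else u 0%N.

Definition gamma_mu (u : nat -> I01) : nat -> R := gamma (mu (uval \o u)).

Lemma mu_itv (u : nat -> I01) n : 0 <= mu (uval \o u) n <= 1.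
Proof.
elim: n => [|n IH]; first exact: uval_itv.
by have := uval_itv (u n.+1); move: IH => /=; case: (lerP (mu _ _) (uval _)); lra.
Qed.

Lemma gamma_mu_itv (u : nat -> I01) n : 0 <= gamma_mu u n <= 1.
Proof.
rewrite /gamma_mu; elim: n => [|n IH]; first exact: uval_itv.
have := mu_itv u n.+1; have : 0 <= 1 / 2 ^+ n :> R by rewrite divr_ge0 ?exprn_ge0.
by move: IH => /=; case: (lerP _ (_ + _)); lra.
Qed.

Lemma gamma_mu_le (u : nat -> I01) n : gamma_mu u n <= mu (uval \o u) n.
Proof. by rewrite /gamma_mu; case: n => [|n] //=; rewrite ge_min lexx. Qed.

Lemma gamma_mu_nondecreasing (u : nat -> I01) :
  nondecreasing_seq (gamma_mu u).
Proof.
apply/nondecreasing_seqP => n; rewrite {2}/gamma_mu /= le_min.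
rewrite (le_trans (gamma_mu_le u n)) ?le_max ?lexx //=.
by rewrite lerDl divr_ge0 ?exprn_ge0.
Qed.

Lemma gamma_mu_step (u : nat -> I01) n :
  gamma_mu u n.+1 - gamma_mu u n <= 1 / 2 ^+ n.
Proof. by rewrite lerBlDl {1}/gamma_mu /= ge_min lexx orbT. Qed.

Lemma gamma_mu_cvgn (u : nat -> I01) : cvgn (gamma_mu u).
Proof.
apply: nondecreasing_is_cvgn; first exact: gamma_mu_nondecreasing.
by exists 1 => _ [n _ <-]; have /andP[] := gamma_mu_itv u n.
Qed.

Lemma delta_subproof (u : nat -> I01) : 0 <= limn (gamma_mu u) <= 1.
Proof.
apply/andP; split.
  apply: limr_ge; first exact: gamma_mu_cvgn.
  by apply: nearW => n; have /andP[] := gamma_mu_itv u n.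
apply: limr_le; first exact: gamma_mu_cvgn.
by apply: nearW => n; have /andP[] := gamma_mu_itv u n.
Qed.

Definition delta (u : nat -> I01) : I01 := mk_unit (delta_subproof u).

Lemma gamma_mu_add_le (u : nat -> I01) n k :
  gamma_mu u (n + k) <= gamma_mu u n + 2 / 2 ^+ n - 2 / 2 ^+ (n + k).
Proof.
elim: k => [|k IH]; first by rewrite addn0; lra.
have := gamma_mu_step u (n + k); rewrite addnS exprS.
have : 2 ^+ (n + k) != 0 :> R by rewrite expf_neq0 // pnatr_eq0.
move: IH; set a := 2 ^+ (n + k) => IH a0.
have -> : 2 / (2 * a) = 1 / a by rewrite invfM mulrA divff // pnatr_eq0.
have : 2 / a = 1 / a + 1 / a by rewrite -mulrDl.
by lra.
Qed.

Lemma delta_bounds (u : nat -> I01) n :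
  gamma_mu u n <= uval (delta u) <= gamma_mu u n + 2 / 2 ^+ n.
Proof.
rewrite mk_unitK; apply/andP; split.
  exact: nondecreasing_cvgn_le (@gamma_mu_nondecreasing u) (@gamma_mu_cvgn u) n.
apply: limr_le; first exact: gamma_mu_cvgn.
near=> m; have nm : (n <= m)%N by near: m; exact: nbhs_infty_ge.
rewrite -(subnKC nm); apply: le_trans (gamma_mu_add_le _ _ _) _.
by rewrite gerBl divr_ge0 ?exprn_ge0.
Unshelve. all: by end_near. Qed.

Lemma gamma_mu_mono (u v : nat -> I01) n :
  (forall i, uval (u i) <= uval (v i)) -> gamma_mu u n <= gamma_mu v n.
Proof.
move=> uv; have mu_uv k : mu (uval \o u) k <= mu (uval \o v) k.
  elim: k => [|k IH] /=; first exact: uv.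
  by rewrite ge_max !le_max IH uv orbT.
rewrite /gamma_mu; elim: n => [|n IH]; first exact: uv.
move: (mu_uv n.+1); rewrite [gamma _ _]/= [gamma (mu (_ \o v)) _]/=.
move=> h; rewrite le_min !ge_min h /= lerD2r IH orbT.
by [].
Qed.

Lemma delta_mono (u v : nat -> I01) :
  (forall i, uval (u i) <= uval (v i)) -> uval (delta u) <= uval (delta v).
Proof.
move=> uv; rewrite !mk_unitK; apply: ler_lim; try exact: gamma_mu_cvgn.
by apply: nearW => n; exact: gamma_mu_mono.
Qed.

Lemma continuous_uval : continuous (uval : I01 -> R).
Proof. exact: initial_continuous. Qed.

Lemma continuous_unit (X : topologicalType) (f : X -> I01) :
  continuous (uval \o f) -> continuous f.
Proof. exact: continuous_comp_initial. Qed.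

Lemma continuous_uval_comp (X : topologicalType) (f : X -> I01) :
  continuous f -> continuous (fun x => uval (f x)).
Proof. by move=> cf x; apply: continuous_comp (cf x) _; exact: continuous_uval. Qed.

Lemma continuous_maxr (X : topologicalType) (f g : X -> R) :
  continuous f -> continuous g -> continuous (fun x => Num.max (f x) (g x)).
Proof. by move=> cf cg x; apply: continuous_max; [exact: cf|exact: cg]. Qed.

Lemma continuous_minr (X : topologicalType) (f g : X -> R) :
  continuous f -> continuous g -> continuous (fun x => Num.min (f x) (g x)).
Proof. by move=> cf cg x; apply: continuous_min; [exact: cf|exact: cg]. Qed.

Lemma continuous_gamma_mu (X : topologicalType) (f : nat -> X -> I01) n :
  (forall i, continuous (f i)) -> continuous (fun x => gamma_mu (f^~ x) n).
Proof.
move=> cf; have cmu k : continuous (fun x => mu (uval \o f^~ x) k).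
  elim: k => [|k IH]; first exact: continuous_uval_comp.
  by apply: continuous_maxr => //; exact: continuous_uval_comp.
rewrite /gamma_mu; elim: n => [|n IH]; first exact: continuous_uval_comp.
apply: continuous_minr; first exact: cmu.
by move=> x; apply: cvgD; [exact: IH|exact: cvg_cst].
Qed.

Lemma continuous_delta (X : topologicalType) (f : nat -> X -> I01) :
  (forall i, continuous (f i)) -> continuous (fun x => delta (f^~ x)).
Proof.
move=> cf; apply: continuous_unit => x; apply/cvgrPdist_le => e e0.
have e20 : 0 < e / 2 by lra.
have [n hn] : exists n, 2 / 2 ^+ n <= e / 2.
  have := @cvg_geometric R 2 (2^-1).
  rewrite ger0_norm ?invr_ge0 // => /(_ _)/cvgr0Pnorm_le.
  have h2 : (2^-1 : R) < 1 by lra.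
  move=> /(_ h2 _ e20) [n _ /(_ n (leqnn n))] hn; exists n.
  move: hn; rewrite /geometric /= ger0_norm ?mulr_ge0 ?exprn_ge0 ?invr_ge0 //.
  by rewrite exprVn.
have /cvgrPdist_le/(_ _ e20) := @continuous_gamma_mu X f n cf x.
apply: filterS => y; rewrite !ler_distl /=.
have := delta_bounds (f^~ x) n; have := delta_bounds (f^~ y) n.
by lra.
Qed.

Lemma uge_closed : closed [set xy : I01 * I01 | (xy.1 <= xy.2)%O].
Proof.
have -> : [set xy : I01 * I01 | (xy.1 <= xy.2)%O] =
    (fun xy : I01 * I01 => uval xy.1 - uval xy.2) @^-1` [set x | 0 <= x].
  by apply/seteqP; split => xy /=; rewrite subr_ge0.
apply: preimage_closed; last exact: closed_ge.
move=> xy _; apply: cvgB; apply: continuous_comp; try exact: continuous_uval.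
  exact: cvg_fst.
exact: cvg_snd.
Qed.

Lemma unit_compact : compact [set: I01].
Proof.
pose cl (x : R) := Num.max 0 (Num.min 1 x).
have clP x : 0 <= cl x <= 1.
  by rewrite /cl le_max lexx ge_max ler01 ge_min lexx.
have -> : [set: I01] = (fun x => mk_unit (clP x)) @` `[0, 1].
  apply/seteqP; split => // u _; exists (uval u).
    by rewrite /= in_itv; exact: uval_itv.
  apply: uval_inj; rewrite mk_unitK /cl.
  by have /andP[h0 h1] := uval_itv u; rewrite (min_idPr h1) (max_idPr h0).
apply: continuous_compact; last exact: segment_compact.
apply: continuous_subspaceT; apply: continuous_unit.
apply: continuous_maxr; first by move=> x; exact: cvg_cst.
by apply: continuous_minr => x; [exact: cvg_cst|exact: cvg_id].
Qed.

End UnitInterval.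

Definition unit_space (R : realType) : posComp :=
  @PosCompSpace (unit_itv R) unit_compact uge_closed.

(* OTens u and OPitch u are the unary operations "- odot u" and
   "- pitchfork u", OPar is "circledcirc". In the arity bool, false is the first
   argument and true the second. ODelta is the operation, subject to no axiom,
   that is added to the signature of A to obtain that of Abar. *)
Inductive abar_sym (R : realType) :=
| OBot | OTop
| OTens of unit_itv R
| OPitch of unit_itv R
| OJoin | OPar
| ODelta.

Arguments OBot {R}.
Arguments OTop {R}.
Arguments OJoin {R}.
Arguments OPar {R}.
Arguments ODelta {R}.

Definition abar_arity (R : realType) (o : abar_sym R) : countType :=
  match o with
  | OBot | OTop => void
  | OTens _ | OPitch _ => unit
  | OJoin | OPar => bool
  | ODelta => nat
  end.

Definition abar_sig (R : realType) : signature :=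
  @Signature (abar_sym R) (@abar_arity R).

Section AbarAxioms.
Context {R : realType}.
Notation I01 := (unit_itv R).
Notation tm := (term (abar_sig R)).

Definition tbot : tm := @App (abar_sig R) OBot (of_void tm).
Definition ttop : tm := @App (abar_sig R) OTop (of_void tm).
Definition ttens (t : tm) (u : I01) : tm :=
  @App (abar_sig R) (OTens u) (fun _ : unit => t).
Definition tpitch (t : tm) (u : I01) : tm :=
  @App (abar_sig R) (OPitch u) (fun _ : unit => t).
Definition tjoin (s t : tm) : tm :=
  @App (abar_sig R) OJoin (fun b : bool => if b then t else s).
Definition tpar (s t : tm) : tm :=
  @App (abar_sig R) OPar (fun b : bool => if b then t else s).

Local Notation "s == t" := (s, t) (only parsing).
Local Notation "s <== t" := (t, tjoin s t) (at level 70, only parsing).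
Local Notation x := (@Var (abar_sig R) 0).
Local Notation y := (@Var (abar_sig R) 1).
Local Notation z := (@Var (abar_sig R) 2).

Lemma lub_premises_countable (S : set I01) : countable S ->
  countable [set (ttens x u <== y) | u in S].
Proof. exact: card_le_trans (card_image_le _ _). Qed.

Local Notation "|- q" := (unconditional q) (at level 80, only parsing).
Local Notation "p |- q" := (implies1 p q) (at level 80, only parsing).

(* "s <== t" is the equation t = s join t. *)
Inductive abar_axioms : set (implication (abar_sig R)) :=
| join_idem : abar_axioms (|- tjoin x x == x)
| join_assoc :
    abar_axioms (|- tjoin x (tjoin y z) == tjoin (tjoin x y) z)
| join_bot : abar_axioms (|- tjoin x tbot == x)
| join_comm : abar_axioms (|- tjoin x y == tjoin y x)
| tens_one : abar_axioms (|- ttens x u1 == x)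
| tens_tens u v :
    abar_axioms (|- ttens (ttens x u) v == ttens x (utens u v))
| bot_tens u : abar_axioms (|- ttens tbot u == tbot)
| join_tens u :
    abar_axioms (|- ttens (tjoin x y) u == tjoin (ttens x u) (ttens y u))
| tens_mono u v : uval u <= uval v ->
    abar_axioms (|- ttens x u <== ttens x v)
| tens_sup (S : set I01) (cS : countable S) v : is_usup S v ->
    abar_axioms (Implication (ttens x v <== y) (lub_premises_countable cS))
| tens_pitch u : abar_axioms (ttens x u <== y |- x <== tpitch y u)
| pitch_tens u : abar_axioms (x <== tpitch y u |- ttens x u <== y)
| par_comm : abar_axioms (|- tpar x y == tpar y x)
| par_assoc : abar_axioms (|- tpar x (tpar y z) == tpar (tpar x y) z)
| par_top : abar_axioms (|- tpar x ttop == x)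
| le_top : abar_axioms (|- x <== ttop)
| par_join :
    abar_axioms (|- tpar x (tjoin y z) == tjoin (tpar x y) (tpar x z))
| par_bot : abar_axioms (|- tpar x tbot == tbot)
| par_tens u : abar_axioms (|- tpar x (ttens y u) == ttens (tpar x y) u).

Definition Abar : category := quasivariety abar_axioms.

Definition unit_interp (o : abar_sym R) : (abar_arity o -> I01) -> I01 :=
  match o return (abar_arity o -> I01) -> I01 with
  | OBot => fun _ => u0
  | OTop => fun _ => u1
  | OTens u => fun a => utens (a tt) u
  | OPitch u => fun a => upitch (a tt) u
  | OJoin => fun a => umax (a false) (a true)
  | OPar => fun a => utens (a false) (a true)
  | ODelta => fun a => delta a
  end.

Definition unit_alg : algebra (abar_sig R) :=
  @Algebra (abar_sig R) I01 unit_interp.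

Lemma umaxE (u v : I01) : uval (umax u v) = Num.max (uval u) (uval v).
Proof. by []. Qed.

Lemma utensE (u v : I01) : uval (utens u v) = Num.max 0 (uval u + uval v - 1).
Proof. by []. Qed.

Lemma upitchE (v u : I01) :
  uval (upitch v u) = Num.min 1 (1 - uval u + uval v).
Proof. by []. Qed.

Lemma u0E : uval (u0 : I01) = 0. Proof. by []. Qed.

Lemma u1E : uval (u1 : I01) = 1. Proof. by []. Qed.

Lemma umax_le (u v : I01) : v = umax u v <-> uval u <= uval v.
Proof.
split=> [->|uv]; first by rewrite umaxE le_max lexx.
by apply: uval_inj; rewrite umaxE (max_idPr uv).
Qed.

Lemma utens_le (u v w : I01) :
  uval (utens u v) <= uval w <-> uval u <= uval (upitch w v).
Proof.
rewrite utensE upitchE ge_max le_min.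
have := uval_itv u; have := uval_itv w.
by move=> hw hu; split=> /andP[h1 h2]; apply/andP; split; lra.
Qed.

Local Ltac max_lra :=
  repeat match goal with
  | |- context [Num.max ?a ?b] =>
    lazymatch b with context [Num.max _ _] => fail | _ =>
    lazymatch a with context [Num.max _ _] => fail | _ =>
      case: (lerP a b) => ?
    end end
  end; lra.

Lemma unit_alg_models : models abar_axioms unit_alg.
Proof.
move=> i ax e; move: (uval_itv (e 0%N)) (uval_itv (e 1%N)) (uval_itv (e 2%N)).
move=> ex ey ez.
case: ax; rewrite /holds /=.
- by move=> *; apply: uval_inj; rewrite umaxE maxxx.
- by move=> *; apply: uval_inj; rewrite !umaxE maxA.
- by move=> *; apply: uval_inj; rewrite umaxE u0E; max_lra.
- by move=> *; apply: uval_inj; rewrite !umaxE maxC.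
- by move=> *; apply: uval_inj; rewrite utensE u1E; max_lra.
- move=> u v *; apply: uval_inj; rewrite !utensE.
  by have := uval_itv u; have := uval_itv v => ? ?; max_lra.
- move=> u *; apply: uval_inj; rewrite !utensE u0E.
  by have := uval_itv u => ?; max_lra.
- by move=> u *; apply: uval_inj; rewrite !(utensE, umaxE); max_lra.
- by move=> u v uv *; apply/umax_le; rewrite !utensE; max_lra.
- move=> S cS v [_ vS] h; apply/umax_le.
  suff : uval v <= uval (upitch (e 1%N) (e 0%N)).
    by move=> /utens_le; rewrite !utensE [uval v + _]addrC.
  apply: vS => u Su; apply/utens_le.
  have /umax_le : e 1%N = umax (utens (e 0%N) u) (e 1%N).
    by apply: (h (ttens x u <== y)); exists u.
  by rewrite !utensE [uval u + _]addrC.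
- by move=> u h; apply/umax_le/utens_le/umax_le; exact: (h _ erefl).
- by move=> u h; apply/umax_le/utens_le/umax_le; exact: (h _ erefl).
- by move=> *; apply: uval_inj; rewrite !utensE [uval (e 0%N) + _]addrC.
- by move=> *; apply: uval_inj; rewrite !utensE; max_lra.
- by move=> *; apply: uval_inj; rewrite utensE u1E; max_lra.
- by move=> *; apply/umax_le; rewrite u1E; lra.
- by move=> *; apply: uval_inj; rewrite !(utensE, umaxE); max_lra.
- by move=> *; apply: uval_inj; rewrite !utensE u0E; max_lra.
- move=> u *; apply: uval_inj; rewrite !utensE.
  by have := uval_itv u => ?; max_lra.
Qed.

Definition unit_abar : Abar := exist _ unit_alg unit_alg_models.

Definition point_separated (A : algebra (abar_sig R)) : Prop :=
  forall a b : A, a <> b -> exists phi : alg_hom A unit_alg, phi a <> phi b.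

Definition in_Abar0 (A : Abar) : Prop := point_separated (sval A).

Definition Abar0 : category := full_sub in_Abar0.

Lemma unit_interp_continuous (X : topologicalType) (o : abar_sym R)
    (a : abar_arity o -> X -> I01) : (forall i, continuous (a i)) ->
  continuous (fun p => unit_interp (o := o) (a^~ p)).
Proof.
case: o a => [||u|u|||] a ca /=.
- by move=> p; exact: cvg_cst.
- by move=> p; exact: cvg_cst.
- apply: continuous_unit; apply: continuous_maxr.
    by move=> p; exact: cvg_cst.
  move=> p; apply: cvgB; last exact: cvg_cst.
  by apply: cvgD; [exact: continuous_uval_comp|exact: cvg_cst].
- apply: continuous_unit; apply: continuous_minr.
    by move=> p; exact: cvg_cst.
  move=> p; apply: cvgD; first exact: cvg_cst.
  exact: continuous_uval_comp.
- by apply: continuous_unit; apply: continuous_maxr; exact: continuous_uval_comp.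
- apply: continuous_unit; apply: continuous_maxr.
    by move=> p; exact: cvg_cst.
  move=> p; apply: cvgB; last exact: cvg_cst.
  by apply: cvgD; exact: continuous_uval_comp.
- exact: continuous_delta.
Qed.

Lemma unit_interp_mono (o : abar_sym R) (a b : abar_arity o -> I01) :
  (forall i, (a i <= b i)%O) -> (unit_interp a <= unit_interp b)%O.
Proof.
rewrite /Order.le /= /uge.
case: o a b => [||u|u|||] a b ab /=.
- by [].
- by [].
- by move: (ab tt); rewrite !utensE => ?; max_lra.
- by move: (ab tt); rewrite !upitchE le_min !ge_min lexx /= => ?;
    apply/orP; right; lra.
- by move: (ab false) (ab true); rewrite !umaxE => ? ?; max_lra.
- by move: (ab false) (ab true); rewrite !utensE => ? ?; max_lra.
- exact: delta_mono.
Qed.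

Section FunctionAlgebra.
Variable X : posComp.

Definition C_interp (o : abar_sym R)
    (a : abar_arity o -> pc_hom X (unit_space R)) : pc_hom X (unit_space R) :=
  @PCHom X (unit_space R) (fun p => unit_interp (fun i => a i p))
    (@unit_interp_continuous X o (fun i => a i)
      (fun i => @pc_continuous _ _ (a i)))
    (fun p q pq => unit_interp_mono (fun i => pc_monotone (a i) pq)).

Definition C_alg : algebra (abar_sig R) :=
  @Algebra (abar_sig R) (@hom PosComp X (unit_space R)) C_interp.

Definition C_eval (p : X) : alg_hom C_alg unit_alg :=
  @AlgHom (abar_sig R) C_alg unit_alg (fun f : pc_hom X (unit_space R) => f p)
    (fun o a => erefl).

Lemma C_alg_models : models abar_axioms C_alg.
Proof.
apply: (models_separated (f := C_eval) _ unit_alg_models) => f g fg.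
by apply: (@pc_hom_ext X (unit_space R)).
Qed.

End FunctionAlgebra.

Definition C_obj (X : posComp) : Abar := exist _ (C_alg X) (@C_alg_models X).

Lemma C_map_subproof (X Y : posComp) (f : pc_hom X Y) (o : abar_sym R)
    (a : abar_arity o -> C_alg Y) :
  pc_comp (interp (C_alg Y) o a) f =
  interp (C_alg X) o ((fun psi : C_alg Y => pc_comp psi f) \o a).
Proof. exact: pc_hom_ext. Qed.

Definition C_map (X Y : posComp) (f : pc_hom X Y) :
    alg_hom (C_alg Y) (C_alg X) :=
  @AlgHom (abar_sig R) (C_alg Y) (C_alg X)
    (fun psi : pc_hom Y (unit_space R) => pc_comp psi f) (C_map_subproof f).

Definition C_functor : functor (op PosComp) Abar.
Proof.
refine (@Functor (op PosComp) Abar C_obj (fun X Y f => C_map f) _ _).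
- move=> X; apply: alg_hom_ext => psi.
  by apply: (@pc_hom_ext X (unit_space R)) => p.
- move=> X Y Z g f; apply: alg_hom_ext => psi.
  by apply: (@pc_hom_ext Z (unit_space R)) => p.
Defined.

End AbarAxioms.

Arguments Abar R : clear implicits.
Arguments Abar0 R : clear implicits.
Arguments C_functor R : clear implicits.
Arguments abar_axioms R : clear implicits.

(* Main.v *)
From HB Require Import structures.
From mathcomp Require Import all_boot all_order all_algebra.
From mathcomp Require Import all_classical all_reals all_analysis.
From mathcomp Require Import lra.
Require Import Defs.

(** The unit interval is at the same time an ordered compact space and
    an algebra with continuous operations, and all assertions reduce to
    compactness arguments in powers of [0, 1].

    Quasivariety and directed colimits. A homomorphism A -> [0, 1] is a
    point of the cube [0, 1]^A that satisfies a family of closed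
    conditions, one for each operation and each choice of arguments.
    That it separates a from b is a countable union of closed
    conditions. Hence (compact_countable_bigcap) a separating
    homomorphism exists as soon as every countable subfamily of the
    conditions is satisfied by a separating point. If A satisfies all
    implications valid in [0, 1], this is the case because a countable
    subfamily is the set of premises of an implication: its conclusion a
    = b fails in A, so it fails in [0, 1] for some valuation. So the
    separated algebras are exactly the models of these implications. If
    A is an aleph1-directed colimit of separated algebras, countably
    many conditions only concern one sufficiently late stage of the
    diagram.

    Duality. The inverse of C maps A to the set of homomorphisms A ->
    [0, 1], with the pointwise topology and order (dual_space). Two
    families of canonical maps have to be isomorphisms.

    The map X -> dual (CX) evaluates at points. It reflects the order by
    Nachbin's separation theorem (monotone_separation), an Urysohn
    construction in which open and closed sets are replaced by open and
    closed upsets. It is onto (C_hom_eval): for a homomorphism Phi on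
    CX, the points x with p x = 0 for all p with Phi p = 0 and q x = 1
    for all q with Phi q = 1 form the intersection of a directed family
    of nonempty closed sets.

    The map A -> C (dual A) is injective when A is separated. It is onto
    by a Stone-Weierstrass argument (dual_eval_surj): closed sets B and
    C such that no point of B lies below a point of C are separated by
    an element of A with values 0 and 1, where powers for circledcirc
    stretch small gaps and compactness combines separations of points;
    joins of such elements, lowered to various heights, approximate
    every monotone continuous function from below with any precision;
    and delta takes the limit. *)

Set Implicit Arguments.
Unset Strict Implicit.
Unset Printing Implicit Defensive.

Import Order.TTheory GRing.Theory Num.Theory.
Import numFieldNormedType.Exports.

Local Open Scope classical_set_scope.
Local Open Scope ring_scope.

(** * Compactness and countable families of closed conditions *)

(** The finite intersection property in the form used throughout: only pairs
    of conditions have to be combined, so no finite families appear. *)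
Lemma compact_directed_bigcap (X : topologicalType) (I : Type) (D : set I)
    (F : I -> set X) (K : set X) :
  compact K -> D !=set0 -> (forall i, D i -> closed (F i)) ->
  (forall i, D i -> K `&` F i !=set0) ->
  (forall i j, D i -> D j -> exists2 k, D k & F k `<=` F i `&` F j) ->
  K `&` \bigcap_(i in D) F i !=set0.
Proof.
move=> Kcpt [i0 Di0] Fcl Fne Fdir.
pose B i := K `&` F i.
have BF : Filter (filter_from D B).
  apply: filter_from_filter; first by exists i0.
  move=> i j Di Dj; have [k Dk sk] := Fdir i j Di Dj.
  by exists k => // x [Kx /sk[]].
have BP : ProperFilter (filter_from D B).
  by apply: filter_from_proper => // i Di; exact: Fne.
have [|x [Kx clx]] := Kcpt _ BP; first by exists i0 => // x [].
exists x; split=> // i Di; apply: (Fcl i Di) => U Ux.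
have [|y [[_ Fy] Uy]] := clx (B i) U _ Ux; first by exists i.
by exists y.
Qed.

Lemma countable_setU (T : Type) (A B : set T) :
  countable A -> countable B -> countable (A `|` B).
Proof.
by move=> cA cB; rewrite -bigcup2E; apply: bigcup_countable => // -[|[|k]] _.
Qed.

(** A condition that is a countable union of closed sets G n behaves, against
    countable tests, like a single closed one: if each G n could be refuted by
    some countable S n, their union would refute all of them at once. *)
Lemma compact_countable_bigcap (X : topologicalType) (P : Type)
    (F : P -> set X) (G : nat -> set X) :
  compact [set: X] -> (forall p, closed (F p)) -> (forall n, closed (G n)) ->
  (forall S : set P, countable S ->
     \bigcap_(p in S) F p `&` \bigcup_n G n !=set0) ->
  \bigcap_p F p `&` \bigcup_n G n !=set0.
Proof.
move=> Xcpt Fcl Gcl FG.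
have [n Gn] : exists n, forall S, countable S ->
    \bigcap_(p in S) F p `&` G n !=set0.
  apply: contrapT => /forallNP no.
  have /choice[S Sn] n : exists S, countable S /\
      ~ (\bigcap_(p in S) F p `&` G n !=set0).
    by have /existsNP[S /not_implyP[cS GS]] := no n; exists S.
  have [|x [Fx [n _ Gx]]] := FG (\bigcup_n S n).
    by apply: bigcup_countable => // n _; exact: (Sn n).1.
  by apply: (Sn n).2; exists x; split=> // p Sp; apply: Fx; exists n.
have [||||x [_ Kx]] := @compact_directed_bigcap X (set P)
    (fun S => countable S)
    (fun S => \bigcap_(p in S) F p `&` G n) setT Xcpt.
- by exists set0; exact: countable0.
- by move=> S _; apply: closedI => //; apply: closed_bigI => p _.
- by move=> S cS; rewrite setTI; exact: Gn.
- move=> S S' cS cS'; exists (S `|` S'); first exact: countable_setU.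
  by move=> x [FS Gx]; split; split=> // p Sp; apply: FS; [left|right].
exists x; split; last by exists n => //; apply: (Kx set0 (countable0 _)).2.
by move=> p _; apply: (Kx _ (countable1 p)).1.
Qed.

Section Cube.
Context {R : realType}.
Notation I01 := (unit_itv R).

(** The indices are taken in {classic T} because T carries no structure. *)
Definition cube (T : Type) : Type := prod_topology (fun _ : {classic T} => I01).

HB.instance Definition _ T := Topological.copy (cube T)
  (prod_topology (fun _ : {classic T} => I01)).

Lemma cube_proj_continuous T (t : T) : continuous (fun e : cube T => e t).
Proof. exact: (@proj_continuous {classic T} (fun=> I01)). Qed.

Lemma continuous_cube (X : topologicalType) T (f : X -> cube T) :
  (forall t, continuous (fun x => f x t)) -> continuous f.
Proof.
move=> cf x; apply/cvg_sup => t.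
exact: (@continuous_comp_initial _ _ _ (fun e : cube T => e t) f (cf t)).
Qed.

Lemma cube_compact T : compact [set: cube T].
Proof.
have := @tychonoff {classic T} (fun=> I01) _ (fun=> unit_compact).
by congr compact; apply/seteqP; split.
Qed.

Lemma closed_eq_unit (X : topologicalType) (f g : X -> I01) :
  continuous f -> continuous g -> closed [set x | f x = g x].
Proof.
move=> cf cg.
have -> : [set x | f x = g x] =
    (fun x => uval (f x) - uval (g x)) @^-1` [set x | x = 0].
  apply/seteqP; split => x /=; first by move=> ->; rewrite subrr.
  by move=> /eqP; rewrite subr_eq0 => /eqP/uval_inj.
apply: preimage_closed; last exact: closed_eq.
by move=> x _; apply: cvgB; exact: continuous_uval_comp.
Qed.

Lemma closed_dist_ge (X : topologicalType) (f g : X -> I01) (c : R) :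
  continuous f -> continuous g ->
  closed [set x | c <= `|uval (f x) - uval (g x)|].
Proof.
move=> cf cg.
apply: (@preimage_closed _ _ _ [set r | c <= r]); last exact: closed_ge.
move=> x _; apply: cvg_norm.
by apply: cvgB; exact: continuous_uval_comp.
Qed.

Lemma closed_unit_le (Y : topologicalType) (f g : Y -> I01) :
  continuous f -> continuous g -> closed [set y | (f y <= g y)%O].
Proof.
move=> cf cg; apply: (@preimage_closed _ _ (fun y => (f y, g y))
  [set uv : I01 * I01 | (uv.1 <= uv.2)%O]); last exact: uge_closed.
move=> y _; exact: (@cvg_pair _ _ _ _ _ _ (nbhs_filter y) (nbhs_filter (f y))
  (nbhs_filter (g y)) f g (cf y) (cg y)).
Qed.

Lemma closed_le_cst (Y : topologicalType) (f : Y -> I01) (c : R) :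
  continuous f -> closed [set x | uval (f x) <= c].
Proof.
move=> cf; apply: (@preimage_closed _ _ (fun x => uval (f x)) [set r | r <= c]).
  by move=> x _; exact: continuous_uval_comp.
exact: closed_le.
Qed.

Lemma closed_ge_cst (Y : topologicalType) (f : Y -> I01) (c : R) :
  continuous f -> closed [set x | c <= uval (f x)].
Proof.
move=> cf; apply: (@preimage_closed _ _ (fun x => uval (f x)) [set r | c <= r]).
  by move=> x _; exact: continuous_uval_comp.
exact: closed_ge.
Qed.

(** Being separated, e a <> e b, is the union over n of the closed conditions
    that e a and e b are at distance at least 1 / (n + 1). *)
Lemma cube_countable_bigcap (T P : Type) (F : P -> set (cube T)) (a b : T) :
  (forall p, closed (F p)) ->
  (forall S : set P, countable S ->
     exists e, (forall p, S p -> F p e) /\ e a <> e b) ->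
  exists e, (forall p, F p e) /\ e a <> e b.
Proof.
move=> Fcl FS.
pose d (e : cube T) : R := `|uval (e a) - uval (e b)|.
have dE e : (exists n, n.+1%:R^-1 <= d e) <-> e a <> e b.
  split=> [[n nd] ab|ab].
    by move: nd; rewrite /d ab subrr normr0 leNgt invr_gt0 ltr0n.
  have d0 : 0 < d e.
    by rewrite normr_gt0 subr_eq0; apply/eqP => /uval_inj.
  have [n nd] : exists n, n.+1%:R^-1 < d e.
    have [n _ /(_ n (leqnn n))] := near_infty_natSinv_lt (PosNum d0).
    by exists n.
  by exists n; exact: ltW.
have [|||e [Fe [n _ Ge]]] := @compact_countable_bigcap (cube T) P F
    (fun n => [set e | n.+1%:R^-1 <= d e]) (@cube_compact T).
- exact: Fcl.
- by move=> n; apply: closed_dist_ge; exact: cube_proj_continuous.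
- move=> S cS; have [e [Fe /dE[n nd]]] := FS S cS.
  by exists e; split; [exact: Fe|exists n].
by exists e; split; [move=> p; exact: Fe|apply/dE; exists n].
Qed.

End Cube.

(** * Separation by homomorphisms is a property of countable subsets *)

Section Homomorphisms.
Context {R : realType}.
Notation I01 := (unit_itv R).
Notation Sg := (abar_sig R).

(** One instance of the homomorphism equations, for a function on B presented
    as the restriction along inj of a function e on A. It is closed because
    the operations of [0, 1] are continuous. *)
Definition hom_condition (A : Type) (B : algebra Sg) (inj : B -> A)
    (c : {o : abar_sym R & abar_arity o -> B}) : set (cube A) :=
  [set e | e (inj (interp B (tag c) (tagged c))) =
           unit_interp (fun i => e (inj (tagged c i)))].

Lemma hom_condition_closed A B inj c : closed (@hom_condition A B inj c).
Proof.
apply: closed_eq_unit; first exact: cube_proj_continuous.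
by apply: unit_interp_continuous => i; exact: cube_proj_continuous.
Qed.

Lemma hom_conditionP A (B : algebra Sg) (inj : B -> A) (e : cube A) :
  (forall c, hom_condition inj c e) ->
  {phi : alg_hom B unit_alg | forall b, phi b = e (inj b)}.
Proof.
move=> he; have hP (o : osym Sg) (a : arity o -> B) :
    e (inj (interp B o a)) = interp unit_alg o ((e \o inj) \o a).
  exact: (he (existT (fun o => abar_arity o -> B) o a)).
by exists (@AlgHom Sg B unit_alg (e \o inj) hP).
Qed.

(** Countably many homomorphism equations are the premises of an implication,
    with the elements of A that occur in them as variables. If they forced
    e a = e b in [0, 1], the implication would be valid in [0, 1], hence in A,
    where the tautological valuation satisfies the premises: so a = b. *)
Lemma countable_diagram_realised (A : algebra Sg)
    (S : set {o : abar_sym R & abar_arity o -> A}) (a b : A) :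
  (forall i : implication Sg, models [set i] unit_alg -> models [set i] A) ->
  countable S -> a <> b ->
  exists e : cube A,
    (forall c, S c -> hom_condition id c e) /\ e a <> e b.
Proof.
move=> AQ cS ab.
pose args (c : {o : abar_sym R & abar_arity o -> A}) : set A :=
  interp A (tag c) (tagged c) |` range (tagged c).
pose V : set A := [set a; b] `|` \bigcup_(c in S) args c.
have cV : countable V.
  apply: countable_setU; first by apply: countable_setU; exact: countable1.
  apply: bigcup_countable => // c _.
  apply: countable_setU; first exact: countable1.
  exact: card_le_trans (card_image_le _ _) (countableP _).
have /countable_injP[code codeI] := cV.
have Va : V a by left; left.
have Vb : V b by left; right.
pose Vx (x : A) (n : nat) := V x /\ code x = n.
(* Outside the range of code the value does not matter. *)
pose decode n : A := if pselect (exists x, Vx x n) is left ex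
  then sval (cid ex) else a.
have codeK x : V x -> decode (code x) = x.
  rewrite /decode => Vx0; case: pselect => [ex|[]]; last by exists x.
  by case: cid => y [/= Vy yx]; apply: codeI => //; exact: mem_set.
pose tm (c : {o : abar_sym R & abar_arity o -> A}) : equation Sg :=
  (@App Sg (tag c) (fun i => Var (code (tagged c i))),
   Var (code (interp A (tag c) (tagged c)))).
have ctm : countable (tm @` S) by exact: card_le_trans (card_image_le _ _) cS.
pose imp := @Implication Sg (tm @` S) (Var (code a), Var (code b)) ctm.
have [e [eS eab]] : exists e : nat -> I01,
    (forall q, premises imp q -> @holds Sg unit_alg e q) /\
    e (code a) <> e (code b).
  apply: contrapT => no; apply: ab.
  rewrite -(codeK a Va) -(codeK b Vb).
  apply: (AQ imp _ imp _ decode) => //.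
    move=> _ -> e he; apply: contrapT => eab.
    by apply: no; exists e.
  move=> _ [c Sc <-]; rewrite /holds /=.
  have VS y : args c y -> V y by move=> cy; right; exists c.
  rewrite codeK; last by apply: VS; left.
  congr (interp A); apply/funext => i; rewrite codeK //.
  by apply: VS; right; exists i.
exists (e \o code); split=> // c Sc.
by have /esym := eS (tm c) (ex_intro2 _ _ c Sc erefl).
Qed.

(** Countably many homomorphism equations at a time are met by
    countable_diagram_realised, and compactness meets all of them together. *)
Lemma implications_of_unit_separate (A : algebra Sg) :
  (forall i : implication Sg, models [set i] unit_alg -> models [set i] A) ->
  point_separated A.
Proof.
move=> AQ a b ab.
have [|e [he eab]] := @cube_countable_bigcap R A _
    (@hom_condition A A id) a b (@hom_condition_closed A A id).
  by move=> S cS; exact: countable_diagram_realised.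
by have [phi phiE] := hom_conditionP he; exists phi; rewrite !phiE.
Qed.

Lemma separated_models (A : algebra Sg) (Q : set (implication Sg)) :
  point_separated A -> models Q unit_alg -> models Q A.
Proof.
move=> sepA; apply: (models_separated (f := @id (alg_hom A unit_alg))).
move=> x y xy; apply: contrapT => /sepA[phi]; exact.
Qed.

Lemma is_aleph1_quasivariety_separated :
  is_aleph1_quasivariety
    (fun A : algebra Sg => models (abar_axioms R) A /\ point_separated A).
Proof.
exists [set i | models [set i] unit_alg] => A; split=> [[_ sepA] i Qi|QA].
  exact: (separated_models sepA Qi) erefl.
have AQ (i : implication Sg) : models [set i] unit_alg -> models [set i] A.
  by move=> Qi _ ->; exact: QA.
split; last exact: implications_of_unit_separate.
move=> i ax; apply: (AQ i _ i erefl) => _ ->.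
exact: unit_alg_models.
Qed.

End Homomorphisms.

(** * Directed colimits *)

Section Subalgebra.
Variables (Sg : signature) (A : algebra Sg) (P : A -> Prop).
Hypothesis Pclosed :
  forall (o : osym Sg) (a : arity o -> A), (forall i, P (a i)) ->
    P (interp A o a).

Definition subalgebra : algebra Sg :=
  @Algebra Sg {x : A | P x} (fun o a =>
    exist P (interp A o (fun i => sval (a i)))
      (Pclosed (fun i => svalP (a i)))).

Definition subalgebra_incl : alg_hom subalgebra A :=
  @AlgHom Sg subalgebra A sval (fun o a => erefl).

Definition subalgebra_corestrict (B : algebra Sg) (f : alg_hom B A)
    (Pf : forall b, P (f b)) : alg_hom B subalgebra.
Proof.
refine (@AlgHom Sg B subalgebra (fun b => exist P (f b) (Pf b)) _) => o a.
by apply: eq_exist; rewrite alg_funE.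
Defined.

Lemma subalgebra_models (Q : set (implication Sg)) :
  models Q A -> models Q subalgebra.
Proof.
apply: (models_separated (f := fun _ : unit => subalgebra_incl)).
by move=> [x Px] [y Py] /(_ tt) /= xy; exact: eq_exist.
Qed.

End Subalgebra.

Local Notation carr X := (carrier (sval X)).

Section DirectedColimits.
Variables (Sg : signature) (Q : set (implication Sg)).
Variables (d : Order.disp_t) (I : porderType d).
Hypothesis Idir : aleph1_directed I.
Variables (D : functor (poset_cat I) (quasivariety Q)) (c : quasivariety Q).
Variable iota : forall i, hom (D i) c.

Let in_image (x : carr c) : Prop := exists i (y : carr (D i)),
  (iota i : alg_hom _ _) y = x.

(** An operation has countably many arguments, so all of them live at a common
    stage of an aleph1-directed diagram. *)
Lemma aleph1_directed_image_closed : is_cocone iota ->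
  forall (o : osym Sg) (a : arity o -> carr c), (forall k, in_image (a k)) ->
    in_image (interp (sval c) o a).
Proof.
move=> cc o a im.
have /choice[t tE] k : exists t : {i : I & carr (D i)},
    (iota (tag t) : alg_hom _ _) (tagged t) = a k.
  by have [i [y yE]] := im k; exists (existT _ i y).
have [i ub] := Idir (card_le_trans (card_image_le (tag \o t) setT)
  (countableP setT)).
have le_i k : (tag (t k) <= i)%O by apply: ub; exists k.
pose y' k : carr (D i) :=
  (@fmap _ _ D (tag (t k)) i (le_i k) : alg_hom _ _) (tagged (t k)).
exists i, (interp (sval (D i)) o y'); rewrite alg_funE.
congr interp; apply/funext => k; rewrite /= -(tE k) /y'.
by rewrite -(cc _ i (le_i k)).
Qed.

(** The elements coming from some stage form a subalgebra; by the universal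
    property its inclusion into the colimit has a section. *)
Lemma aleph1_directed_colimit_surj : is_colimit iota -> forall x, in_image x.
Proof.
move=> [cc colim] x.
pose Bcl := aleph1_directed_image_closed cc.
pose B : quasivariety Q :=
  exist (models Q) (subalgebra Bcl) (@subalgebra_models _ _ _ Bcl Q (svalP c)).
have im i (y : carr (D i)) : in_image ((iota i : alg_hom _ _) y).
  by exists i, y.
pose iotaB i : hom (D i) B := subalgebra_corestrict _ (im i).
have ccB : is_cocone iotaB.
  move=> i j f; apply: alg_hom_ext => y; apply: eq_exist => /=.
  exact: (congr1 (fun h : alg_hom _ _ => h y) (cc i j f)).
have [h [hE _]] := colim B iotaB ccB.
pose incl : hom B c := subalgebra_incl Bcl.
have [h1 [_ h1U]] := colim c iota cc.
have inclh : comp incl h = idc c.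
  rewrite -(h1U (comp incl h)); first by apply: h1U => j; exact: comp1f.
  by move=> j; rewrite -compA hE; exact: alg_hom_ext.
have -> : x = sval ((h : alg_hom _ _) x).
  exact: (esym (congr1 (fun g : alg_hom _ _ => g x) inclh)).
exact: svalP.
Qed.

End DirectedColimits.

(** A homomorphism on the colimit is a compatible family of homomorphisms on
    the stages, that is, a point of a cube subject to closed conditions.
    Countably many conditions mention countably many stages, and a
    homomorphism on a common later stage satisfies them; it can be chosen to
    separate the given points because the later stage is separated. *)
Lemma closed_aleph1_directed_colimits_separated (R : realType) :
  closed_aleph1_directed_colimits (@in_Abar0 R).
Proof.
move=> d I Idir D c iota colim sepD a b ab.
have [cc univ] := colim.
have surj := aleph1_directed_colimit_surj Idir colim.
have [i [a' [b' [aE bE]]]] : exists (i : I) (a' b' : carr (D i)),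
    (iota i : alg_hom _ _) a' = a /\ (iota i : alg_hom _ _) b' = b.
  have [ia [a0 a0E]] := surj a; have [ib [b0 b0E]] := surj b.
  have [i ub] := Idir _ (finite_set_countable (finite_set2 (ia : I) (ib : I))).
  have lea : (ia <= i)%O by apply: ub; left.
  have leb : (ib <= i)%O by apply: ub; right.
  exists i, ((@fmap _ _ D ia i lea : alg_hom _ _) a0),
    ((@fmap _ _ D ib i leb : alg_hom _ _) b0); split.
    by rewrite -a0E -(cc ia i lea).
  by rewrite -b0E -(cc ib i leb).
(* A point of the cube over T is a family of functions on the stages; F lists
   the conditions that they are homomorphisms and that they are compatible. *)
pose T := {j : I & carr (D j)}.
pose tr j k (jk : (j <= k)%O) : alg_hom (sval (D j)) (sval (D k)) :=
  @fmap _ _ D j k jk.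
pose homc := {j : I & {o : abar_sym R & abar_arity o -> carr (D j)}}.
pose natc := {jk : I * I & ((jk.1 <= jk.2)%O * carr (D jk.1))%type}.
pose F (p : homc + natc) : set (cube T) :=
  match p with
  | inl c => hom_condition (fun x => existT _ (tag c) x) (tagged c)
  | inr c => [set e | e (existT _ (tag c).1 (tagged c).2) =
                e (existT _ (tag c).2 (tr _ _ (tagged c).1 (tagged c).2))]
  end.
pose idx (p : homc + natc) : set I :=
  match p with inl c => [set tag c] | inr c => [set (tag c).1; (tag c).2] end.
have [||e [he eab]] := @cube_countable_bigcap R T _ F
    (existT _ i a') (existT _ i b').
- case=> [c0|c0]; first exact: hom_condition_closed.
  by apply: closed_eq_unit; exact: cube_proj_continuous.
- move=> S cS.
  have cidx : countable (i |` \bigcup_(p in S) idx p).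
    apply: countable_setU; first exact: countable1.
    apply: bigcup_countable => // -[c0|c0] _ //=.
    exact/finite_set_countable/finite_set2.
  have [k ub] := Idir _ cidx.
  have ik : (i <= k)%O by apply: ub; left.
  have [|phi phiab] := sepD k (tr _ _ ik a') (tr _ _ ik b').
    move=> tab; apply: ab; rewrite -aE -bE -(cc i k ik) /=.
    by congr (alg_fun _ _).
  (* The conditions in S only mention stages below k. *)
  pose e (t : T) : unit_itv R :=
    if pselect (tag t <= k)%O is left tk then phi (tr _ _ tk (tagged t))
    else u0.
  have eE j x (jk : (j <= k)%O) : e (existT _ j x) = phi (tr _ _ jk x).
    rewrite /e /=; case: pselect => [jk'|//].
    by rewrite (bool_irrelevance jk jk').
  exists e; split; last by rewrite !eE.
  case=> [[j [s x]] | [[j l] [jl x]]] Sp /=.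
    have jk : (j <= k)%O.
      by apply: ub; right; exists (inl (existT _ j (existT _ s x))).
    rewrite /hom_condition /= eE !alg_funE /=.
    congr (unit_interp _); apply/funext => m /=.
    by rewrite eE.
  have jlS : \bigcup_(p in S) idx p `<=` [set m | m <= k]%O.
    by move=> m Sm; apply: ub; right.
  have jk : (j <= k)%O by apply: jlS; eexists; [exact: Sp|left].
  have lk : (l <= k)%O by apply: jlS; eexists; [exact: Sp|right].
  rewrite !eE; congr (alg_fun phi _).
  have := @fmapM _ _ D j l k lk jl.
  move=> /(congr1 (fun h : alg_hom _ _ => h x)) /= <-.
  by rewrite /tr; congr (alg_fun (fmap D _) _); exact: bool_irrelevance.
have phiP j : {phi : alg_hom (sval (D j)) unit_alg |
    forall x, phi x = e (existT _ j x)}.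
  apply: (@hom_conditionP R T (sval (D j)) (fun x => existT _ j x) e) => c0.
  exact: (he (inl (existT _ j c0))).
pose phi j : hom (D j) (@unit_abar R) := sval (phiP j).
have ccphi : is_cocone phi.
  move=> j k jk; apply: alg_hom_ext => x /=.
  rewrite /phi !(svalP (phiP _)).
  by have := he (inr (existT _ (j, k) (jk, x))) => /= ->.
have [h [hE _]] := univ _ phi ccphi.
have hphi j x : (h : alg_hom _ _) ((iota j : alg_hom _ _) x) = e (existT _ j x).
  rewrite -(svalP (phiP j)).
  exact: (congr1 (fun g : alg_hom _ _ => g x) (hE j)).
by exists h; rewrite -aE -bE !hphi.
Qed.

(** * Limits computed by delta *)

Section DeltaLimits.
Context {R : realType}.
Notation I01 := (unit_itv R).

Lemma pow2_small (c e : R) : 0 <= c -> 0 < e -> exists n, c / 2 ^+ n <= e.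
Proof.
move=> c0 e0; have := @cvg_geometric R c (2^-1).
rewrite ger0_norm ?invr_ge0 // invf_lt1 // ltr1n => /(_ isT).
move=> /cvgr0Pnorm_le/(_ _ e0)[n _ /(_ n (leqnn n))] hn; exists n.
move: hn; rewrite /geometric /= ger0_norm ?mulr_ge0 ?exprn_ge0 ?invr_ge0 //.
by rewrite exprVn.
Qed.

Lemma pow2_gt0 n : 0 < 1 / 2 ^+ n :> R.
Proof. by rewrite divr_gt0 ?exprn_gt0. Qed.

Lemma pow2S n : 1 / 2 ^+ n.+1 = (1 / 2 ^+ n) / 2 :> R.
Proof. by rewrite exprS invfM [2^-1 * _]mulrC mulrA. Qed.

(** gamma truncates the increments of a sequence; it does nothing if they are
    small already. *)
Lemma gamma_mu_eq_mu (u : nat -> I01) :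
  (forall n, uval (u n.+1) <= mu (uval \o u) n + 1 / 2 ^+ n) ->
  gamma_mu u =1 mu (uval \o u).
Proof.
move=> ustep; elim=> [//|n IH].
have E : gamma_mu u n.+1 =
    Num.min (mu (uval \o u) n.+1) (gamma_mu u n + 1 / 2 ^+ n) by [].
rewrite E IH; apply/min_idPl => /=.
by rewrite ge_max ustep lerDl ltW // pow2_gt0.
Qed.

Lemma mu_id (u : nat -> R) :
  (forall n, u n <= u n.+1) -> mu u =1 u.
Proof. by move=> uS; elim=> [//|n IH] /=; rewrite IH; exact/max_idPr. Qed.

Lemma mu_le (u : nat -> R) l : (forall n, u n <= l) -> forall n, mu u n <= l.
Proof. by move=> ul; elim=> [|n IH] /=; rewrite ?ge_max ?IH ul. Qed.

Lemma mu_ge (u : nat -> R) n : u n <= mu u n.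
Proof. by case: n => [|n] //=; rewrite le_max lexx orbT. Qed.

(** This is what delta is for: a point is delta of any sequence that
    approximates it from below with error 1 / 2 ^ n, so that the values of a
    subalgebra of functions are closed under uniform limits. *)
Lemma delta_approx (u : nat -> I01) (l : I01) :
  (forall n, uval l - 1 / 2 ^+ n <= uval (u n) <= uval l) -> delta u = l.
Proof.
move=> ul; have ule n : uval (u n) <= uval l by have /andP[] := ul n.
have mule n : mu (uval \o u) n <= uval l by apply: mu_le.
have lmu n : uval l - 1 / 2 ^+ n <= mu (uval \o u) n.
  by apply: le_trans (mu_ge _ _) => /=; have /andP[] := ul n.
have gm : gamma_mu u =1 mu (uval \o u).
  apply: gamma_mu_eq_mu => n; apply: le_trans (ule _) _.
  by rewrite -lerBlDr.
apply: uval_inj; apply/eqP; rewrite eq_le; apply/andP.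
split; apply/ler_addgt0Pr => e e0.
  have [n ne] := @pow2_small 2 e (ler0n _ _) e0.
  have := delta_bounds u n; rewrite gm; have := mule n; lra.
have [n ne] := @pow2_small 1 e ler01 e0.
have := delta_bounds u n; rewrite gm; have := lmu n; lra.
Qed.

End DeltaLimits.

(** * Separation by monotone functions *)

Section OrderedUrysohn.
Variable X : posComp.

Definition upset (A : set X) := forall x y, A x -> (x <= y)%O -> A y.

(** Closedness of the order gives p <= q whenever p and q cannot be separated
    by neighbourhoods; antisymmetry does the rest. *)
Lemma pc_hausdorff : hausdorff_space X.
Proof.
have cluster_le (p q : X) :
    (forall U V, nbhs p U -> nbhs q V -> U `&` V !=set0) -> (p <= q)%O.
  move=> pq; apply: (@pc_closed X (p, q)) => B [[U V] [/= Up Vq] UVB].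
  have [z [Uz Vz]] := pq U V Up Vq; exists (z, z); split; first exact: lexx.
  by apply: UVB.
move=> p q pq; apply/le_anti/andP; split; apply: cluster_le => U V Up Vq.
  exact: pq.
by rewrite setIC; exact: pq.
Qed.

(** The image of a closed set under a closed relation is a projection of a
    compact set. *)
Lemma closed_le_image (K : set X) (r : set (X * X)) :
  closed K -> closed r -> closed [set y | exists2 x, K x & r (x, y)].
Proof.
move=> Kcl rcl.
have -> : [set y | exists2 x, K x & r (x, y)] = snd @` (r `&` fst @^-1` K).
  apply/seteqP; split => y; first by move=> [x Kx rxy]; exists (x, y).
  by move=> [[x z] /= [rxz Kx] <-]; exists x.
apply: (compact_closed pc_hausdorff); apply: continuous_compact.
  by apply: continuous_subspaceT => -[x y]; exact: cvg_snd.
apply: (@subclosed_compact _ _ setT).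
- apply: closedI => //; apply: preimage_closed => // -[x y] _; exact: cvg_fst.
- rewrite -setXTT; apply: compact_setX; exact: pc_compact.
- by [].
Qed.

Definition separable_pair (KW : set X * set X) :=
  [/\ closed KW.1, upset KW.1, open KW.2, upset KW.2 & KW.1 `<=` KW.2].

(** Normality, made monotone: with K included in V open and the closure of V
    included in W, take the up-closure of the closure of V, and the largest
    upset included in V, whose complement is the down-closure of that of V. *)
Lemma upset_interpolation (KW : set X * set X) : separable_pair KW ->
  exists UK : set X * set X,
    [/\ separable_pair (KW.1, UK.1), separable_pair (UK.2, KW.2) &
        UK.1 `<=` UK.2].
Proof.
case: KW => K W [/= Kcl Kup Wop Wup KW].
have nbW : set_nbhs K W.
  by apply/set_nbhsP; exists W; split=> //; exact: subset_refl.
have [N /set_nbhsP[V [Vop KV VN]] NW] :=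
  compact_normal pc_hausdorff (@pc_compact X) Kcl nbW.
pose K' := [set y : X | exists2 x, closure V x & (x <= y)%O].
pose U' := ~` [set x : X | exists2 y, (~` V) y & (x <= y)%O].
have K'cl : closed K'.
  exact: closed_le_image (@closed_closure _ V) (@pc_closed X).
have U'op : open U'.
  apply: closed_openC.
  apply: (@closed_le_image (~` V) [set yx | (yx.2 <= yx.1)%O]).
    exact: open_closedC.
  apply: (@preimage_closed _ _ (fun xy : X * X => (xy.2, xy.1))
    [set xy | (xy.1 <= xy.2)%O]); last exact: pc_closed.
  by move=> xy _; apply: cvg_pair; [exact: cvg_snd|exact: cvg_fst].
have U'up : upset U'.
  move=> x y U'x xy [z Vz yz]; apply: U'x.
  by exists z => //; exact: le_trans yz.
have K'up : upset K'.
  by move=> x y [z Vz zx] xy; exists z => //; exact: le_trans xy.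
have KU' : K `<=` U' by move=> x Kx [y Vy xy]; apply/Vy/KV/(Kup x).
have U'V : U' `<=` V.
  by move=> x U'x; apply: contrapT => Vx; apply: U'x; exists x.
have K'W : K' `<=` W.
  by move=> y [x Vx xy]; apply: Wup xy; apply/NW/(closure_subset VN).
have U'K' : U' `<=` K'.
  by move=> x U'x; exists x => //; exact/subset_closure/U'V.
by exists (U', K'); split.
Qed.

Section Approximants.
Context {R : realType}.
Variable mid : set X * set X -> set X * set X.
Hypothesis midP : forall KW, separable_pair KW ->
  [/\ separable_pair (KW.1, (mid KW).1), separable_pair ((mid KW).2, KW.2) &
      (mid KW).1 `<=` (mid KW).2].

(** The dyadic construction of a function with value 0 on K and 1 off W,
    organised as a recursion on the interpolating pair (U', K') given by mid:
    the n-th approximation is half of the previous one for (K, U') on U', and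
    1 / 2 plus half of the previous one for (K', W) elsewhere. In this form
    every property follows by induction on n, with K and W varying. *)
Fixpoint urysohn_approx (n : nat) (KW : set X * set X) (x : X) : R :=
  if n is m.+1 then
    if `[< (mid KW).1 x >] then urysohn_approx m (KW.1, (mid KW).1) x / 2
    else 1 / 2 + urysohn_approx m ((mid KW).2, KW.2) x / 2
  else if `[< KW.2 x >] then 0 else 1.

Lemma urysohn_approxS n KW x : urysohn_approx n.+1 KW x =
  if `[< (mid KW).1 x >] then urysohn_approx n (KW.1, (mid KW).1) x / 2
  else 1 / 2 + urysohn_approx n ((mid KW).2, KW.2) x / 2.
Proof. by []. Qed.

Lemma urysohn_approx_itv n KW x : 0 <= urysohn_approx n KW x <= 1.
Proof.
elim: n KW => [|n IH] KW /=; first by case: asboolP; lra.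
by case: asboolP => _; [have := IH (KW.1, (mid KW).1)|
  have := IH ((mid KW).2, KW.2)]; lra.
Qed.

Lemma urysohn_approx0 n KW x : separable_pair KW -> KW.1 x ->
  urysohn_approx n KW x = 0.
Proof.
elim: n KW => [|n IH] KW /= sKW Kx.
  by case: sKW => _ _ _ _ /(_ _ Kx) Wx; rewrite asboolT.
have [sl _ _] := midP sKW; have [_ _ _ _ /(_ _ Kx) /= Ux] := sl.
by rewrite asboolT // IH //; lra.
Qed.

Lemma urysohn_approx1 n KW x : separable_pair KW -> ~ KW.2 x ->
  urysohn_approx n KW x = 1.
Proof.
elim: n KW => [|n IH] KW /= sKW Wx; first by rewrite asboolF.
have [_ sr UK] := midP sKW; have [_ _ _ _ /= K'W] := sr.
by rewrite asboolF => [|/UK/K'W//]; rewrite IH //; lra.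
Qed.

Lemma urysohn_approx_anti n KW x y : separable_pair KW -> (x <= y)%O ->
  urysohn_approx n KW y <= urysohn_approx n KW x.
Proof.
elim: n KW => [|n IH] KW sKW xy /=.
  have [_ _ _ Wup _] := sKW.
  case: (asboolP (KW.2 y)) => Wy; case: asboolP => Wx //.
  by case: Wy; exact: Wup Wx xy.
have [sl sr _] := midP sKW; have [_ _ _ /= Uup _] := sl.
have := IH _ sl xy; have := IH _ sr xy.
have := urysohn_approx_itv n (KW.1, (mid KW).1) y.
have := urysohn_approx_itv n ((mid KW).2, KW.2) x.
case: (asboolP ((mid KW).1 y)) => Uy; case: asboolP => Ux; try by lra.
by case: Uy; exact: Uup Ux xy.
Qed.

Lemma urysohn_approx_step n KW x : separable_pair KW ->
  urysohn_approx n KW x <= urysohn_approx n.+1 KW x <=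
  urysohn_approx n KW x + 1 / 2 ^+ n.
Proof.
elim: n KW => [|n IH] KW sKW.
  have itv := urysohn_approx_itv 1 KW x; rewrite expr0.
  have [Wx|Wx] := pselect (KW.2 x); last by rewrite !urysohn_approx1 //; lra.
  have -> : urysohn_approx 0 KW x = 0 by rewrite /= asboolT.
  by lra.
have [sl sr _] := midP sKW; move: (IH _ sl) (IH _ sr); rewrite pow2S.
rewrite (urysohn_approxS n.+1 KW) (urysohn_approxS n KW).
by case: asboolP => _; lra.
Qed.

(** The approximations are not continuous, but the n-th one oscillates by at
    most 1 / 2 ^ n near each point. *)
Lemma urysohn_approx_osc n KW x : separable_pair KW ->
  \forall y \near x,
    `|urysohn_approx n KW x - urysohn_approx n KW y| <= 1 / 2 ^+ n.
Proof.
elim: n KW => [|n IH] KW sKW.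
  apply: nearW => y; have := urysohn_approx_itv 0 KW x.
  by have := urysohn_approx_itv 0 KW y; rewrite expr0 ler_norml; lra.
have [sl sr UK] := midP sKW.
have [_ _ /= Uop _ _] := sl; have [/= Kcl _ _ _ _] := sr.
have := IH _ sl; have := IH _ sr; rewrite pow2S.
have [Ux|Ux] := pselect ((mid KW).1 x).
  move=> _ near_l; have : \forall y \near x, (mid KW).1 y.
    exact: open_nbhs_nbhs.
  move: near_l; apply: filterS2 => y h Uy /=; rewrite !asboolT //.
  by move: h; rewrite !ler_norml; lra.
have [Kx|Kx] := pselect ((mid KW).2 x); last first.
  move=> near_r _; have : \forall y \near x, ~ (mid KW).2 y.
    by apply: open_nbhs_nbhs; split=> //; exact: closed_openC.
  move: near_r; apply: filterS2 => y h Ky /=; rewrite !asboolF //.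
    by move: h; rewrite !ler_norml; lra.
  by move=> /UK.
(* Near a point x of K' outside U' both branches occur, but they agree at x:
   both are equal to 1 / 2 there. *)
apply: filterS2 => y /=; rewrite (asboolF Ux).
rewrite (urysohn_approx0 n sr Kx) (urysohn_approx1 n sl Ux).
by case: asboolP => _; rewrite !ler_norml; lra.
Qed.

Definition urysohn_approx_unit KW x n : unit_itv R :=
  mk_unit (urysohn_approx_itv n KW x).

(** The approximations increase by steps of at most 1 / 2 ^ n, so delta
    computes their limit, with values in [0, 1] and monotonicity for free. *)
Definition urysohn_limit KW x : unit_itv R := delta (urysohn_approx_unit KW x).

Lemma urysohn_limit_bounds n KW x : separable_pair KW ->
  urysohn_approx n KW x <= uval (urysohn_limit KW x) <=
  urysohn_approx n KW x + 2 / 2 ^+ n.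
Proof.
move=> sKW; have := delta_bounds (urysohn_approx_unit KW x) n.
have muE : mu (uval \o urysohn_approx_unit KW x) =1
    (fun m => urysohn_approx m KW x).
  by apply: mu_id => m; have /andP[] := (@urysohn_approx_step m KW x sKW).
rewrite gamma_mu_eq_mu ?muE // => m; rewrite muE.
by have /andP[] := (@urysohn_approx_step m KW x sKW).
Qed.

Lemma urysohn_limit_anti KW x y : separable_pair KW -> (x <= y)%O ->
  uval (urysohn_limit KW y) <= uval (urysohn_limit KW x).
Proof.
by move=> sKW xy; apply: delta_mono => n; exact: urysohn_approx_anti.
Qed.

Lemma urysohn_limit_continuous KW : separable_pair KW ->
  continuous (urysohn_limit KW).
Proof.
move=> sKW; apply: continuous_unit => x; apply/cvgrPdist_le => e e0.
have [n ne] := @pow2_small R 3 e (ler0n _ _) e0.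
have := @urysohn_approx_osc n KW x sKW; apply: filterS => y; rewrite !ler_norml.
have := @urysohn_limit_bounds n KW x sKW.
have := @urysohn_limit_bounds n KW y sKW.
move: ne; have -> : 3 / 2 ^+ n = 2 / 2 ^+ n + 1 / 2 ^+ n :> R.
  by rewrite -mulrDl natr1.
by rewrite /=; lra.
Qed.

End Approximants.

(** Nachbin's separation theorem, from the pair formed by the upset generated
    by x and the complement of the downset generated by y. *)
Lemma monotone_separation (R : realType) (x y : X) : ~~ (x <= y)%O ->
  exists f : pc_hom X (unit_space R), uval (f x) < uval (f y).
Proof.
move=> nxy.
have [mid midP] : {mid : set X * set X -> set X * set X |
    forall KW, separable_pair KW ->
    [/\ separable_pair (KW.1, (mid KW).1), separable_pair ((mid KW).2, KW.2) &
        (mid KW).1 `<=` (mid KW).2]}.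
  suff /choice[f fP] : forall KW, exists UK, separable_pair KW ->
      [/\ separable_pair (KW.1, UK.1), separable_pair (UK.2, KW.2) &
          UK.1 `<=` UK.2] by exists f.
  move=> KW; have [/upset_interpolation[UK ?]|] := pselect (separable_pair KW).
    by exists UK.
  by exists KW.
pose KW := ([set z | (x <= z)%O], ~` [set z | (z <= y)%O]).
have sKW : separable_pair KW.
  split=> /=.
  - have clx : closed [set x].
      by apply: (compact_closed pc_hausdorff); exact: compact_set1.
    have := closed_le_image clx (@pc_closed X).
    by congr closed; apply/seteqP; split=> z /=; [move=> [_ -> //]|exists x].
  - by move=> z t /= xz zt; exact: le_trans zt.
  - apply: closed_openC.
    apply: (@preimage_closed _ _ (fun z => (z, y))
      [set xy : X * X | (xy.1 <= xy.2)%O]).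
      by move=> z _; apply: cvg_pair; [exact: cvg_id|exact: cvg_cst].
    exact: pc_closed.
  - by move=> z t /= zy zt ty; apply: zy; exact: le_trans ty.
  - by move=> z /= xz zy; move: nxy; rewrite (le_trans xz zy).
exists (@PCHom X (unit_space R) (urysohn_limit mid KW)
  (urysohn_limit_continuous midP sKW)
  (fun z t zt => urysohn_limit_anti midP sKW zt)) => /=.
have fx0 : urysohn_approx mid 2 KW x = 0 :> R.
  by apply: (urysohn_approx0 midP) => //=.
have fy1 : urysohn_approx mid 0 KW y = 1 :> R.
  by apply: (urysohn_approx1 midP) => //=; apply.
(* At index 2 the error is 1 / 2, small enough to separate 0 from 1. *)
have := urysohn_limit_bounds (R := R) midP 2 x sKW.
have := urysohn_limit_bounds (R := R) midP 0 y sKW.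
by rewrite fx0 fy1 expr0 expr2; lra.
Qed.

End OrderedUrysohn.

(** * The ordered compact space of homomorphisms into [0, 1] *)

(** A filter on the source has a cluster point because its image does, and
    that cluster point can be taken in the range. *)
Lemma compact_initial (S : choiceType) (T : topologicalType) (f : S -> T) :
  compact (range f) -> compact [set: initial_topology f].
Proof.
move=> fcpt F FF _.
have [|t [[s _ <-] cl]] := fcpt (f @ F) _.
  by apply: (@filterS _ F _ setT _ _ filterT) => s _; exists s.
exists s; split=> // A U FA [_ [[W Wop <-] Ws WU]].
have [||_ [[a Aa <-] Wa]] := cl (f @` A) W.
- by apply: (@filterS _ F _ A _ _ FA) => a Aa; exists a.
- exact: open_nbhs_nbhs.
by exists a; split=> //; exact: WU.
Qed.

Section Operations.
Context {R : realType}.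
Notation I01 := (unit_itv R).
Notation Sg := (abar_sig R).
Variable A : algebra Sg.
Implicit Types (a b : A) (u : I01) (phi : alg_hom A (@unit_alg R)).

Definition abot : A := interp A OBot (of_void A).
Definition atop : A := interp A OTop (of_void A).
Definition atens u a : A := interp A (OTens u) (fun _ : unit => a).
Definition apitch u a : A := interp A (OPitch u) (fun _ : unit => a).
Definition ajoin a b : A := interp A OJoin (fun i : bool => if i then b else a).
Definition apar a b : A := interp A OPar (fun i : bool => if i then b else a).
Definition adelta (a : nat -> A) : A := interp A ODelta a.

Lemma hom_bot phi : uval (phi abot) = 0. Proof. by rewrite alg_funE. Qed.
Lemma hom_top phi : uval (phi atop) = 1. Proof. by rewrite alg_funE. Qed.
Lemma hom_tens phi u a :
  uval (phi (atens u a)) = Num.max 0 (uval (phi a) + uval u - 1).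
Proof. by rewrite alg_funE. Qed.
Lemma hom_pitch phi u a :
  uval (phi (apitch u a)) = Num.min 1 (1 - uval u + uval (phi a)).
Proof. by rewrite alg_funE. Qed.
Lemma hom_join phi a b :
  uval (phi (ajoin a b)) = Num.max (uval (phi a)) (uval (phi b)).
Proof. by rewrite alg_funE. Qed.
Lemma hom_par phi a b :
  uval (phi (apar a b)) = Num.max 0 (uval (phi a) + uval (phi b) - 1).
Proof. by rewrite alg_funE. Qed.
Lemma hom_delta phi (a : nat -> A) : phi (adelta a) = delta (phi \o a).
Proof. by rewrite alg_funE. Qed.
End Operations.

Section Dual.
Context {R : realType}.
Notation I01 := (unit_itv R).
Notation Sg := (abar_sig R).

Definition dual (A : algebra Sg) : Type := alg_hom A (@unit_alg R).
(** The dual carries the topology of pointwise convergence. *)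
Definition dual_fun (A : algebra Sg) (phi : dual A) : cube A := phi.

HB.instance Definition _ A := gen_eqMixin (dual A).
HB.instance Definition _ A := gen_choiceMixin (dual A).
HB.instance Definition _ A :=
  Topological.copy (dual A) (initial_topology (@dual_fun A)).

Variable A : algebra Sg.

Definition dual_le (phi psi : dual A) : bool :=
  `[< forall a, uge (phi a) (psi a) >].

Lemma dual_le_refl : reflexive dual_le.
Proof. by move=> phi; apply/asboolP => a; exact: uge_refl. Qed.

Lemma dual_le_anti : antisymmetric dual_le.
Proof.
move=> phi psi /andP[/asboolP h /asboolP k]; apply: alg_hom_ext => a.
by apply: uge_anti; rewrite h k.
Qed.

Lemma dual_le_trans : transitive dual_le.
Proof.
move=> psi phi chi /asboolP h /asboolP k; apply/asboolP => a.
exact: uge_trans (h a) (k a).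
Qed.

HB.instance Definition _ :=
  Order.Le_isPOrder.Build Order.default_display (dual A)
    dual_le_refl dual_le_anti dual_le_trans.

Lemma dual_eval_continuous (a : A) : continuous (fun phi : dual A => phi a).
Proof.
move=> phi.
apply: (@continuous_comp _ _ _ (@dual_fun A) (fun e : cube A => e a)).
  exact: initial_continuous.
exact: cube_proj_continuous.
Qed.

Lemma dual_compact : compact [set: dual A].
Proof.
apply: compact_initial.
have -> : range (@dual_fun A) = \bigcap_c hom_condition id c.
  apply/seteqP; split => [_ [phi _ <-] c _|e he].
    by rewrite /hom_condition /= /dual_fun alg_funE.
  have [|phi phiE] := @hom_conditionP R A A id e.
    by move=> c; exact: he.
  by exists phi => //; apply/funext.
apply: (@subclosed_compact _ _ setT) => //; last exact: cube_compact.
by apply: closed_bigI => c _; exact: hom_condition_closed.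
Qed.

Lemma dual_closed_compact (K : set (dual A)) : closed K -> compact K.
Proof. by move=> Kcl; exact: subclosed_compact Kcl dual_compact _. Qed.

Lemma dual_closed : closed [set xy : dual A * dual A | (xy.1 <= xy.2)%O].
Proof.
have -> : [set xy : dual A * dual A | (xy.1 <= xy.2)%O] =
    \bigcap_(a in [set: A])
      [set xy : dual A * dual A | (xy.1 a <= xy.2 a :> I01)%O].
  apply/seteqP; split => xy /=; first by move=> /asboolP h a _; exact: h.
  by move=> h; apply/asboolP => a; exact: h.
apply: closed_bigI => a _; apply: closed_unit_le => xy.
  apply: (@continuous_comp _ _ _ fst (fun phi : dual A => phi a)).
    exact: cvg_fst.
  exact: dual_eval_continuous.
apply: (@continuous_comp _ _ _ snd (fun phi : dual A => phi a)).
  exact: cvg_snd.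
exact: dual_eval_continuous.
Qed.

Definition dual_space : posComp :=
  @PosCompSpace (dual A) dual_compact dual_closed.

Lemma continuous_dual (X : topologicalType) (f : X -> dual A) :
  (forall a, continuous (fun x => f x a)) -> continuous f.
Proof.
by move=> cf; apply: continuous_comp_initial; exact: continuous_cube.
Qed.

End Dual.

(** * Homomorphisms on CX are evaluations *)

Section Evaluation.
Context {R : realType}.
Variable X : posComp.
Notation I01 := (unit_itv R).
Notation CX := (@C_alg R X).

Lemma C_hom_mono (Phi : alg_hom CX unit_alg) (f g : CX) :
  (forall x, uval (C_eval x f) <= uval (C_eval x g)) ->
  uval (Phi f) <= uval (Phi g).
Proof.
move=> fg; have E : g = ajoin f g.
  apply: (@pc_hom_ext X (unit_space R)) => x.
  by apply/(umax_le (C_eval x f) (C_eval x g)).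
by rewrite [in leRHS]E hom_join le_max lexx.
Qed.

(** Call p small if Phi p = 0 and q large if Phi q = 1. The conditions
    p x <= e and q x >= 1 - e are closed, and directed since joins of small
    functions are small and products of large ones are large. They are
    consistent: otherwise q (.) e, that is max (0, q + e - 1), lies below p,
    while Phi maps it to e > 0 and p to 0. A common point x satisfies Phi f =
    f x, since f (.) (1 - Phi f) is small and f pitchfork Phi f is large. *)
Lemma C_hom_eval (Phi : alg_hom CX unit_alg) :
  exists x, forall f : CX, Phi f = C_eval x f.
Proof.
pose D := [set i : CX * CX * I01 |
  [/\ uval (Phi i.1.1) = 0, uval (Phi i.1.2) = 1 & 0 < uval i.2]].
pose F (i : CX * CX * I01) := [set x : X |
  uval (C_eval x i.1.1) <= uval i.2 /\ 1 - uval i.2 <= uval (C_eval x i.1.2)].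
have [||||x [_ xF]] := @compact_directed_bigcap X _ D F setT (@pc_compact X).
- by exists (abot CX, atop CX, u1); split; rewrite ?hom_bot ?hom_top ?u1E.
- move=> [[p q] e] _; apply: closedI.
    exact: (@closed_le_cst R X (p : pc_hom X (unit_space R)) (uval e)
      (@pc_continuous _ _ p)).
  exact: (@closed_ge_cst R X (q : pc_hom X (unit_space R)) (1 - uval e)
    (@pc_continuous _ _ q)).
- move=> [[p q] e] [/= p0 q1 e0]; rewrite setTI; apply: contrapT => F0.
  have : uval (Phi (atens e q)) <= uval (Phi p).
    apply: C_hom_mono => x; rewrite hom_tens ge_max.
    have := uval_itv (C_eval x q); have := uval_itv (C_eval x p).
    have [px|px] := lerP (uval (C_eval x p)) (uval e); last by lra.
    have [qx|qx] := lerP (1 - uval e) (uval (C_eval x q)); last by lra.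
    by case: F0; exists x; split.
  by rewrite hom_tens p0 q1 ge_max; lra.
- move=> [[p q] e] [[p' q'] e'] [/= p0 q1 e0] [/= p0' q1' e0'].
  exists (ajoin p p', apar q q', if uval e <= uval e' then e else e').
    split=> /=; rewrite ?hom_join ?hom_par ?p0 ?p0' ?q1 ?q1' ?maxxx //.
      by case: lerP; lra.
    by case: ifP.
  set e'' : I01 := if _ then _ else _; move=> x [h1 h2].
  have {}h1 : uval (C_eval x (ajoin p p')) <= uval e'' := h1.
  have {}h2 : 1 - uval e'' <= uval (C_eval x (apar q q')) := h2.
  move: h1 h2; rewrite hom_join hom_par ge_max le_max.
  have := uval_itv (C_eval x q); have := uval_itv (C_eval x q').
  have e''e : uval e'' <= uval e by rewrite /e''; case: (lerP (uval e)); lra.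
  have e''e' : uval e'' <= uval e' by rewrite /e''; case: (lerP (uval e)); lra.
  by move=> hq' hq /andP[hp hp'] /orP[hqq|hqq]; split; split=> /=; lra.
exists x => f; apply: uval_inj; apply/eqP; rewrite -subr_eq0.
apply: contrapT => /negP; rewrite -normr_gt0; set d := `|_| => d0.
have hP := uval_itv (Phi f); have hx := uval_itv (C_eval x f).
have e01 : 0 <= d / 2 <= 1.
  have : d <= 1 by rewrite /d ler_norml; lra.
  by lra.
have c01 : 0 <= 1 - uval (Phi f) <= 1 by lra.
have [|h1 h2] := xF (atens (mk_unit c01) f, apitch (Phi f) f, mk_unit e01).
  by split=> /=; rewrite ?hom_tens ?hom_pitch ?mk_unitK; [rewrite max_l|
    rewrite min_l|]; lra.
have {}h1 : uval (C_eval x (atens (mk_unit c01) f)) <= d / 2 := h1.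
have {}h2 : 1 - d / 2 <= uval (C_eval x (apitch (Phi f) f)) := h2.
move: h1 h2; rewrite hom_tens hom_pitch !mk_unitK ge_max le_min.
move=> /andP[_ h1] /andP[_ h2].
have : d <= d / 2 by rewrite {1}/d ler_norml; lra.
by lra.
Qed.

End Evaluation.

(** * A Stone-Weierstrass theorem *)

Section StoneWeierstrass.
Context {R : realType}.
Notation I01 := (unit_itv R).
Variable A : algebra (abar_sig R).
Implicit Types (phi psi : dual A) (a b : A).
Implicit Type f : pc_hom (dual_space A) (unit_space R).

Lemma half_itv : 0 <= (1 / 2 : R) <= 1. Proof. lra. Qed.

Definition apow a n : A := iter n (apar a) a.

Lemma hom_pow phi a n :
  uval (phi (apow a n)) = Num.max 0 (1 - (1 - uval (phi a)) *+ n.+1).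
Proof.
have := uval_itv (phi a); set x := uval (phi a) => hx.
elim: n => [|n IH]; first by rewrite mulr1n max_r /apow /= -/x; lra.
rewrite /apow iterS hom_par -/(apow a n) IH -/x (mulrS _ n.+1).
have : 0 <= (1 - x) *+ n.+1 by rewrite mulrn_wge0; lra.
set y := (1 - x) *+ n.+1 => y0.
by case: (lerP 0 (1 - y)) => h1; case: lerP => ?; case: lerP => ?; lra.
Qed.

(** If phi a < psi a, a shift makes psi a equal to 1, and powers for
    circledcirc then multiply the gap between phi a and 1. *)
Lemma dual_separation phi psi : ~~ (phi <= psi)%O ->
  exists a, uval (phi a) = 0 /\ uval (psi a) = 1.
Proof.
move=> /asboolP/existsNP[a /negP]; rewrite -ltNge => pa.
pose b := apitch (psi a) a.
have psib : uval (psi b) = 1 by rewrite hom_pitch min_l; lra.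
have phib : uval (phi b) < 1 by rewrite hom_pitch gt_min ltxx /=; lra.
have d0 : 0 < 1 - uval (phi b) by lra.
have [n _ /(_ n (leqnn n)) /= nd] := near_infty_natSinv_lt (PosNum d0).
have {}nd : 1 < (1 - uval (phi b)) *+ n.+1.
  by rewrite -mulr_natr -ltr_pdivrMr ?ltr0n // div1r.
exists (apow b n); rewrite !hom_pow psib subrr mul0rn subr0; split.
  by rewrite max_l // subr_le0 ltW.
by rewrite max_r.
Qed.

(** Two compactness arguments, one for the points of B with psi fixed, one for
    the points of C; the families are directed thanks to circledcirc and to
    joins respectively. *)
Lemma dual_urysohn (B C : set (dual A)) : closed B -> closed C ->
  (forall phi psi, B phi -> C psi -> ~~ (phi <= psi)%O) ->
  exists a, (forall phi, B phi -> uval (phi a) = 0) /\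
            (forall psi, C psi -> uval (psi a) = 1).
Proof.
move=> Bcl Ccl BC.
have step1 psi : C psi -> exists a, uval (psi a) = 1 /\
    (forall phi, B phi -> uval (phi a) = 0).
  move=> Cpsi.
  have [a [psia aB]] : exists a, uval (psi a) = 1 /\
      forall phi, B phi -> uval (phi a) < 1 / 2.
    apply: contrapT => no.
    have [||||phi [Bphi phiF]] := @compact_directed_bigcap (dual A) A
        [set a | uval (psi a) = 1]
        (fun a => [set phi : dual A | 1 / 2 <= uval (phi a)])
        B (dual_closed_compact Bcl).
    - by exists (atop A); rewrite /= hom_top.
    - by move=> a _; apply: closed_ge_cst; exact: dual_eval_continuous.
    - move=> a psia; apply: contrapT => aB; apply: no.
      exists a; split=> // phi Bphi.
      by rewrite ltNge; apply/negP => h; apply: aB; exists phi.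
    - move=> a b /= psia psib; exists (apar a b).
        by rewrite /= hom_par psia psib max_r; lra.
      move=> phi /=; rewrite hom_par le_max.
      by have := uval_itv (phi a); have := uval_itv (phi b); split; lra.
    have [a [phia psia]] := dual_separation (BC _ _ Bphi Cpsi).
    by have := phiF a psia; rewrite /= phia; lra.
  (* The square maps values below 1 / 2 to 0, and 1 to 1. *)
  exists (apar a a); split=> [|phi Bphi]; rewrite hom_par ?psia.
    by rewrite max_r; lra.
  by rewrite max_l //; have := aB phi Bphi; lra.
have [a [aB aC]] : exists a, (forall phi, B phi -> uval (phi a) = 0) /\
    (forall psi, C psi -> 1 / 2 < uval (psi a)).
  apply: contrapT => no.
  have [||||psi [Cpsi psiF]] := @compact_directed_bigcap (dual A) A
      [set a | forall phi, B phi -> uval (phi a) = 0]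
      (fun a => [set psi : dual A | uval (psi a) <= 1 / 2])
      C (dual_closed_compact Ccl).
  - by exists (abot A) => phi _; rewrite hom_bot.
  - by move=> a _; apply: closed_le_cst; exact: dual_eval_continuous.
  - move=> a aB; apply: contrapT => aC; apply: no.
    exists a; split=> // psi Cpsi.
    by rewrite ltNge; apply/negP => h; apply: aC; exists psi.
  - move=> a b aB bB; exists (ajoin a b).
      by move=> phi Bphi; rewrite hom_join aB // bB // maxxx.
    by move=> psi /=; rewrite hom_join ge_max => /andP[].
  have [a [psia aB]] := step1 psi Cpsi.
  by have := psiF a aB; rewrite /= psia; lra.
(* Adding 1 / 2 turns values above 1 / 2 into 1 and 0 into 1 / 2, which the
   square maps to 0. *)
pose b := apitch (mk_unit half_itv) a.
exists (apar b b); split=> [phi Bphi|psi Cpsi];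
  rewrite hom_par hom_pitch mk_unitK.
  by rewrite aB // min_r ?max_l; lra.
by have := aC psi Cpsi => ?; rewrite min_l ?max_r; lra.
Qed.

(** The function f is approximated from below by the join over k of functions
    bounded by k h that vanish where f <= k h and equal k h where f >= (k + 1)
    h. The minimum in the lower bound says that after m steps the
    approximation is good only up to height (m + 1) h. *)
Lemma dual_approx_steps f (h : R) m : 0 < h -> m%:R * h <= 1 ->
  exists a, forall phi,
    Num.min (uval (f phi)) (m.+1%:R * h) - 2 * h <= uval (phi a) <=
    uval (f phi).
Proof.
move=> h0; elim: m => [_|m IH mh].
  exists (abot A) => phi; have := uval_itv (f phi); rewrite hom_bot mul1r.
  by have [?|?] := lerP (uval (f phi)) h; lra.
have mhS : m.+1%:R * h = m%:R * h + h by rewrite -natr1 mulrDl mul1r.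
have m0 : 0 <= m%:R * h by rewrite mulr_ge0 // ltW.
have [|a aP] := IH; first by lra.
have fcont : continuous (f : dual A -> I01) := @pc_continuous _ _ f.
have [||phi psi /= phiB psiC|b [bB bC]] := @dual_urysohn
  [set phi | uval (f phi) <= m%:R * h] [set psi | m.+1%:R * h <= uval (f psi)].
- exact: closed_le_cst.
- exact: closed_ge_cst.
- apply/negP => /(pc_monotone f); rewrite /Order.le /= /uge; lra.
have cP : 0 <= m%:R * h <= 1 by lra.
exists (ajoin a (atens (mk_unit cP) b)) => phi.
rewrite hom_join hom_tens mk_unitK.
have := aP phi; have := uval_itv (phi b); have := uval_itv (f phi).
have mhSS : m.+2%:R * h = m%:R * h + h + h by rewrite -natr1 mulrDl mul1r mhS.
rewrite mhSS mhS; have bf : uval (phi b) = 0 \/ m%:R * h < uval (f phi).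
  by have [fl|fh] := lerP (uval (f phi)) (m%:R * h); [left; exact: bB|right].
have bf' : uval (phi b) = 1 \/ uval (f phi) < m%:R * h + h.
  have [fh|fl] := lerP (m%:R * h + h) (uval (f phi)); last by right.
  by left; apply: bC; rewrite /= mhS.
set x := uval (f phi) in bf bf' *; set y := uval (phi b) in bf bf' *.
set c := m%:R * h in bf bf' m0 cP *.
move=> hx hy /andP[ax xa]; apply/andP; split; last first.
  by rewrite !ge_max; case: bf => ?; lra.
case: bf' => [y1|xc].
  apply: (@le_trans _ _ c); first by rewrite lerBlDr ge_min; lra.
  by rewrite !le_max y1; apply/orP; right; apply/orP; right; lra.
by rewrite le_max; apply/orP; left; move: ax; rewrite !min_l; lra.
Qed.

Lemma dual_approx f n : exists a, forall phi,
  uval (f phi) - 1 / 2 ^+ n <= uval (phi a) <= uval (f phi).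
Proof.
have p0 : 0 < 2 ^+ n.+1 :> R by rewrite exprn_gt0.
have [||a aP] := @dual_approx_steps f (1 / 2 ^+ n.+1) (2 ^ n.+1).
- exact: pow2_gt0.
- by rewrite natrX mulrC mulfVK ?gt_eqF.
exists a => phi; have := aP phi.
rewrite -natr1 mulrDl natrX mulrC mulfVK ?gt_eqF //.
have := uval_itv (f phi); have := pow2_gt0 n.+1 (R := R) => q0 fphi.
have -> : 2 * (1 / 2 ^+ n.+1) = 1 / 2 ^+ n :> R by rewrite pow2S mulrC mulfVK.
by rewrite min_l; lra.
Qed.

(** delta turns the approximations of dual_approx into an equality. *)
Lemma dual_eval_surj f : exists a, forall phi, phi a = f phi.
Proof.
have /choice[a aP] := dual_approx f.
exists (adelta a) => phi; rewrite hom_delta.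
by apply: delta_approx => n; exact: aP.
Qed.

End StoneWeierstrass.

(** * The duality *)

Lemma nat_isomorphic_sym (K L : category) (F G : functor K L) :
  nat_isomorphic F G -> nat_isomorphic G F.
Proof.
move=> [eta [nat iso]].
have [theta thetaP] : {theta : forall a, hom (G a) (F a) | forall a,
    comp (theta a) (eta a) = idc (F a) /\ comp (eta a) (theta a) = idc (G a)}.
  by exists (fun a => sval (cid (iso a))) => a; case: cid.
exists theta; split=> [a b f|a]; last by exists (eta a); have [] := thetaP a.
rewrite -[LHS]compf1 -(thetaP a).2 compA -(compA (theta b)) -nat.
by rewrite (compA (theta b)) (thetaP b).1 comp1f.
Qed.

Lemma alg_bij_iso (Sg : signature) (A B : algebra Sg) (f : alg_hom A B) :
  injective f -> (forall b, exists a, f a = b) -> @is_iso (alg_cat Sg) A B f.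
Proof.
move=> finj /choice[g fg].
have gM (o : osym Sg) (b : arity o -> B) :
    g (interp B o b) = interp A o (g \o b).
  apply: finj; rewrite fg alg_funE; congr interp.
  by apply/funext => i /=; rewrite fg.
exists (AlgHom gM); split; apply: alg_hom_ext => x /=; last exact: fg.
by apply: finj; rewrite fg.
Qed.

(** Order-reflecting maps are injective, and a continuous bijection between
    compact Hausdorff spaces is closed, so the inverse is continuous. *)
Lemma pc_order_iso (X Y : posComp) (f : pc_hom X Y) :
  (forall y, exists x, f x = y) ->
  (forall x x', (f x <= f x')%O -> (x <= x')%O) -> @is_iso PosComp X Y f.
Proof.
move=> /choice[g fg] fle.
have gf x : g (f x) = x.
  by apply/le_anti/andP; split; apply: fle; rewrite fg.
have gcont : continuous g.
  apply/continuous_closedP => K Kcl.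
  have -> : g @^-1` K = f @` K.
    apply/seteqP; split => [y Ky|_ [x Kx <-]]; last by rewrite /= gf.
    by exists (g y).
  apply: (compact_closed (@pc_hausdorff Y)); apply: continuous_compact.
    by apply: continuous_subspaceT; exact: pc_continuous.
  exact: (subclosed_compact Kcl (@pc_compact X)).
have gmono : {homo g : x y / (x <= y)%O}.
  by move=> x y xy; apply: fle; rewrite !fg.
exists (PCHom gcont gmono).
by split; apply: pc_hom_ext => x; rewrite /= ?gf ?fg.
Qed.

Section Duality.
Context {R : realType}.
Notation Sg := (abar_sig R).

Lemma C_eval_continuous (X : posComp) :
  continuous (@C_eval R X : X -> dual (@C_alg R X)).
Proof. by apply: continuous_dual => f; exact: (@pc_continuous _ _ f). Qed.

Lemma C_eval_mono (X : posComp) :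
  {homo (@C_eval R X : X -> dual (@C_alg R X)) : x y / (x <= y)%O}.
Proof. by move=> x y xy; apply/asboolP => f; exact: (pc_monotone f xy). Qed.

Definition to_bidual (X : posComp) : pc_hom X (dual_space (@C_alg R X)) :=
  @PCHom X (dual_space (@C_alg R X)) _ (@C_eval_continuous X) (@C_eval_mono X).

(** Order reflection is Nachbin's theorem. *)
Lemma to_bidual_iso (X : posComp) : @is_iso PosComp _ _ (to_bidual X).
Proof.
apply: pc_order_iso => [Phi|x y /asboolP xy].
  by have [x xE] := C_hom_eval Phi; exists x; apply: alg_hom_ext => f.
apply: contrapT => /negP/(monotone_separation R)[f].
by rewrite ltNge => /negP; apply; exact: (xy f).
Qed.

Lemma in_Abar0_C (X : op PosComp) : in_Abar0 (C_functor R X).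
Proof.
move=> f g fg; apply: contrapT => /forallNP no; apply: fg.
apply: (@pc_hom_ext X (unit_space R)) => x.
exact: contrapT (no (C_eval x)).
Qed.

Lemma dual_eval_mono (A : algebra Sg) (a : A) :
  {homo (fun phi : dual A => phi a) : phi psi / (phi <= psi)%O}.
Proof. by move=> phi psi /asboolP; apply. Qed.

Definition dual_eval (A : algebra Sg) (a : A) :
    pc_hom (dual_space A) (unit_space R) :=
  @PCHom (dual_space A) (unit_space R) _ (@dual_eval_continuous R A a)
    (@dual_eval_mono A a).

Lemma dual_eval_funE (A : algebra Sg) (o : osym Sg) (a : arity o -> A) :
  dual_eval (interp A o a) =
  interp (C_alg (dual_space A)) o (@dual_eval A \o a).
Proof.
apply: (@pc_hom_ext (dual_space A) (unit_space R)) => phi.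
exact: (alg_funE phi).
Qed.

Definition unit_hom (A : algebra Sg) : alg_hom A (C_alg (dual_space A)) :=
  @AlgHom Sg A (C_alg (dual_space A)) (@dual_eval A) (@dual_eval_funE A).

(** Injectivity is the definition of point separation, surjectivity is the
    Stone-Weierstrass theorem. *)
Lemma unit_hom_iso (A : algebra Sg) :
  point_separated A -> @is_iso (alg_cat Sg) _ _ (unit_hom A).
Proof.
move=> sepA; apply: alg_bij_iso => [a b ab|f].
  apply: contrapT => /sepA[phi]; apply.
  exact: (congr1 (@C_eval R (dual_space A) phi) ab).
have [a aE] := dual_eval_surj f; exists a.
exact: (@pc_hom_ext (dual_space A) (unit_space R)).
Qed.

Lemma dual_map_continuous (A B : algebra Sg) (h : alg_hom A B) :
  continuous (fun phi : dual B => alg_comp phi h : dual A).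
Proof. by apply: continuous_dual => a; exact: dual_eval_continuous. Qed.

Lemma dual_map_mono (A B : algebra Sg) (h : alg_hom A B) :
  {homo (fun phi : dual B => alg_comp phi h : dual A) :
    phi psi / (phi <= psi)%O}.
Proof. by move=> phi psi /asboolP le; apply/asboolP => a; exact: le. Qed.

Definition dual_map (A B : algebra Sg) (h : alg_hom A B) :
    pc_hom (dual_space B) (dual_space A) :=
  @PCHom (dual_space B) (dual_space A) _
    (@dual_map_continuous A B h) (@dual_map_mono A B h).

Definition dual_functor : functor (Abar0 R) (op PosComp).
Proof.
refine (@Functor (Abar0 R) (op PosComp) (fun A => dual_space (sval (sval A)))
  (fun A B h => dual_map h) _ _).
- by move=> A; apply: pc_hom_ext => phi; exact: alg_hom_ext.
- by move=> A B C g f; apply: pc_hom_ext => phi; exact: alg_hom_ext.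
Defined.

Lemma C_equivalence : is_equivalence
  (corestrict in_Abar0_C : functor (op PosComp) (Abar0 R)).
Proof.
exists dual_functor; split.
  exists to_bidual; split=> [X Y f|X].
    by apply: pc_hom_ext => y; exact: alg_hom_ext.
  by have [g [gf fg]] := to_bidual_iso X; exists g.
apply: nat_isomorphic_sym.
exists (fun A : Abar0 R => unit_hom (sval (sval A))); split=> [A B h|A].
  apply: alg_hom_ext => a.
  exact: (@pc_hom_ext (dual_space (sval (sval B))) (unit_space R)).
exact: (unit_hom_iso (svalP A)).
Qed.

End Duality.

Theorem theorem3p15 (R : realType) :
  (exists C_in_Abar0 : forall X : op PosComp, in_Abar0 (C_functor R X),
     is_equivalence (corestrict C_in_Abar0 : functor (op PosComp) (Abar0 R)))
  /\ closed_aleph1_directed_colimits (@in_Abar0 R)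
  /\ is_aleph1_quasivariety
       (fun A : algebra (abar_sig R) => models (abar_axioms R) A /\ point_separated A).
Proof.
split; first by exists (@in_Abar0_C R); exact: C_equivalence.
split; first exact: closed_aleph1_directed_colimits_separated.
exact: is_aleph1_quasivariety_separated.
Qed.
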